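(* Let $\mathcal H$ be a real or complex Hilbert space, let $\mathcal D\subseteq\mathcal H$ be a linear subspace and let $S:\mathcal D\to\mathcal H$, $\|S\|=1$, be a symmetric operator. Then $$S_m:=(I+S)_N-I\qquad\text{and}\qquad S_M:=I-(I-S)_N$$ are self-adjoint extensions of $S$ having norm $1$. Moreover, $$[S_m,S_M]=\{\widetilde S\in\mathcal B(\mathcal H):\ \widetilde S^*=\widetilde S,\ \|\widetilde S\|=1,\ S\subset\widetilde S\}.$$
   Context: $S:\mathcal D\to\mathcal H$ is symmetric if $\langle Sf,g\rangle=\langle f,Sg\rangle$ for all $f,g\in\mathcal D$; $\|S\|=\sup\{\|Sf\|: f\in\mathcal D,\ \|f\|\le1\}$. The subspace $\mathcal D$ is not assumed dense or closed. $\mathcal B(\mathcal H)$ is the set of everywhere defined bounded operators on $\mathcal H$, $S\subset\widetilde S$ means that $\widetilde S$ extends $S$, and $[S_m,S_M]:=\{\widetilde S\in\mathcal B(\mathcal H): \widetilde S^*=\widetilde S,\ S_m\le\widetilde S\le S_M\}$ with the usual order of bounded self-adjoint operators. $I\pm S$ are regarded as operators with domain $\mathcal D$; they are positive symmetric and possess bounded positive extensions to $\mathcal H$. For an operator $T:\mathcal D\to\mathcal H$ possessing a bounded positive (everywhere defined, self-adjoint) extension to $\mathcal H$, $T_N$ denotes its Krein-von Neumann extension, i.e. its smallest positive self-adjoint extension, which is bounded. Concretely $T_N=J_T^{**}J_T^*$, where $\mathcal E_T$ is the completion of $\operatorname{ran}T$ under the inner product $\langle Tf,Th\rangle_{\mathcal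 E}:=\langle Tf,h\rangle$, and $J_T:\mathcal E_T\to\mathcal H$ is the densely defined closable operator with $\operatorname{dom}J_T=\operatorname{ran}T$ and $J_T(Th):=Th$. *)

(* Defs.v *)
From HB Require Import structures.
From mathcomp Require Import all_boot all_order all_algebra sesquilinear.
From mathcomp Require Import complex.
From mathcomp Require Import boolp classical_sets functions reals ereal.
From mathcomp Require Import topology normedtype.

Set Implicit Arguments.
Unset Strict Implicit.
Unset Printing Implicit Defensive.

Import Order.TTheory GRing.Theory Num.Theory.
Import numFieldNormedType.Exports.

Local Open Scope classical_set_scope.
Local Open Scope ring_scope.

Inductive scalar_kind := RealScalars | ComplexScalars.

Definition scalars (R : realType) (k : scalar_kind) : numFieldType :=
  match k with RealScalars => R | ComplexScalars => R[i] end.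

Definition scalar_conj (R : realType) (k : scalar_kind) :
    {rmorphism scalars R k -> scalars R k} :=
  match k with RealScalars => idfun | ComplexScalars => Num.conj end.

Definition scalar_re (R : realType) (k : scalar_kind) : scalars R k -> R :=
  match k with RealScalars => id | ComplexScalars => @complex.Re R end.

(* [inner] is linear in its first argument and conjugate-linear in its second.
   As usual for normed modules over a numFieldType, the norm is scalar-valued,
   and [0 <= z] in R[i] means that z is a nonnegative real. *)
HB.mixin Record isHilbert (R : realType) (k : scalar_kind) H
    of CompleteNormedModule (scalars R k) H := {
  inner : {dot H for scalar_conj R k};
  inner_normE : forall x : H, inner x x = `|x| ^+ 2 }.

#[short(type="hilbertType")]
HB.structure Definition Hilbert (R : realType) (k : scalar_kind) :=
  {H of isHilbert R k H & CompleteNormedModule (scalars R k) H}.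

Definition linear_subspace (K : numFieldType) (V : lmodType K) (D : set V) :=
  D 0 /\ forall (a : K) x y, D x -> D y -> D (a *: x + y).

Definition linear_on (K : numFieldType) (V W : lmodType K) (D : set V)
    (T : V -> W) :=
  forall (a : K) x y, D x -> D y -> T (a *: x + y) = a *: T x + T y.

(* An operator T : D -> F with domain D is encoded by D and a total function
   whose values outside D are irrelevant; its graph is a subset of E * F. *)
Definition graph (E F : Type) (D : set E) (T : E -> F) : set (E * F) :=
  [set (x, T x) | x in D].

Definition comp_graph (E F G : Type) (B : set (F * G)) (A : set (E * F)) :
    set (E * G) :=
  [set p | exists2 y, A (p.1, y) & B (y, p.2)].

Section Operators.
Context {R : realType} {k : scalar_kind}.

(* The adjoint on the level of graphs: (h, e) belongs to A^* iff
   <y, h> = <x, e> for all (x, y) in A. *)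
Definition adjoint (E F : hilbertType R k) (A : set (E * F)) : set (F * E) :=
  [set q | forall p, A p -> inner p.2 q.1 = inner p.1 q.2].

Variable H : hilbertType R k.
Implicit Types (D : set H) (T A B : H -> H).

Definition symmetric_on D T :=
  forall f g, D f -> D g -> inner (T f) g = inner f (T g).

Definition opnorm D T : \bar R :=
  ereal_sup [set (scalar_re `|T f|)%:E | f in [set f | D f /\ `|f| <= 1]].

Definition bounded_operator A := linear A /\ (opnorm setT A < +oo)%E.

Definition self_adjoint A := adjoint (graph setT A) = graph setT A.

Definition extends D T A := forall f, D f -> A f = T f.

Definition op_le A B := forall f, inner (A f) f <= inner (B f) f.

Definition op_interval A B : set (H -> H) :=
  [set C | [/\ bounded_operator C, self_adjoint C, op_le A C & op_le C B]].

(* (E, iota) is a completion of ran T for the inner product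
   <Tf, Th>_E = <Tf, h>. *)
Definition energy_completion D T (E : hilbertType R k) (iota : H -> E) :=
  [/\ linear_on (T @` D) iota,
      (forall f h, D f -> D h ->
         inner (iota (T f)) (iota (T h)) = inner (T f) h)
    & dense (iota @` (T @` D))].

(* The graph of J_T : iota (T h) |-> T h. *)
Definition energy_map D T (E : hilbertType R k) (iota : H -> E) :
    set (E * H) :=
  [set (iota y, y) | y in T @` D].

Definition is_krein_neumann D T A :=
  exists (E : hilbertType R k) (iota : H -> E),
    energy_completion D T iota /\
    graph setT A =
      let J := energy_map D T iota in
      comp_graph (adjoint (adjoint J)) (adjoint J).

(* J_T^** J_T^* does not depend on the completion. When it is not an everywhere
   defined operator on H (e.g. when T has no bounded positive extension), [get]
   returns an unspecified function. *)
Definition krein_neumann D T : H -> H := get (is_krein_neumann D T).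

End Operators.

(* Main.v *)
(* For a positive symmetric [T] on [D] with [|T f|^2 <= c^2 <T f, f>], the map
   [J_T] is bounded, so by Riesz [J_T^*] is everywhere defined and
   [<g, A h> = <J_T^* g, J_T^* h>] for [A = J_T^** J_T^*]. By density of [ran T]
   in the energy space, [<A h, h>] is the smallest [M^2] with
   [|<T f, h>| <= M <T f, f>^(1/2)] on [D]; hence [A] is the smallest positive
   extension of [T]. Applied to [T = I + S] and [T = I - S], where [c^2 = 2],
   this gives [0 <= A <= 2], so that [S_m] and [S_M] are self-adjoint contractions
   extending [S], extremal among all of them. Conversely, if [S_m <= A <= S_M]
   then the positive operator [A - S_m] has vanishing form on [D], hence vanishes
   there by Cauchy-Schwarz. *)
From HB Require Import structures.
Require Import Defs.
From mathcomp Require Import all_boot all_order all_algebra sesquilinear.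
From mathcomp Require Import complex.
From mathcomp Require Import boolp classical_sets functions reals ereal.
From mathcomp Require Import topology normedtype.
From mathcomp Require Import ring lra.

Set Implicit Arguments.
Unset Strict Implicit.
Unset Printing Implicit Defensive.

Import Order.TTheory GRing.Theory Num.Theory.
Import numFieldNormedType.Exports.

Local Open Scope classical_set_scope.
Local Open Scope ring_scope.

(** The work lies in [get]: nothing is known about [krein_neumann D T] until some completion of
    [ran T] has been exhibited as a [hilbertType]. No quotient of Cauchy sequences is formed.
    Boundedness of [J_T] sends energy-Cauchy sequences [T g_n] to norm-convergent ones, and the
    limit [x] in [H] determines the abstract limit, because its energy product with each [T f] is
    [inner x f] and [ran T] is dense. So the completion can be a subspace of [H] with a second inner
    product, whose vectors are recognised by approximation in norm together with approximation
    against [D]. As [get] does not reveal which completion lies behind its value, the properties of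
    [J_T^** J_T^*] are proved for an arbitrary one. Norms take values in [K], which is [R] or
    [R[i]]; estimates are pulled back to [R], and a quadratic form has to be shown real before it is
    compared in [K]. Only [I + S] is treated in detail: [I - S] is [I + (- S)], so [S_M] is the
    negative of the lower extension built from [- S], and minimality turns into maximality. *)

Section Scalars.
Context {R : realType} {k : scalar_kind}.
Local Notation K := (scalars R k).
Local Notation conj := (scalar_conj R k).
Local Notation re := (@scalar_re R k).
Implicit Types (z w : K) (r s : R).

Definition of_real : R -> K :=
  match k return R -> scalars R k with
  | RealScalars => id | ComplexScalars => real_complex R end.

Lemma scalar_reD z w : re (z + w) = re z + re w.
Proof. by rewrite /scalar_re; case: k z w => // -[a b] [c d]. Qed.

Lemma scalar_reN z : re (- z) = - re z.
Proof. by rewrite /scalar_re; case: k z => // -[a b]. Qed.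

Lemma scalar_reB z w : re (z - w) = re z - re w.
Proof. by rewrite scalar_reD scalar_reN. Qed.

Lemma scalar_re0 : re 0 = 0.
Proof. by rewrite /scalar_re; case: k. Qed.

Lemma of_realK r : re (of_real r) = r.
Proof. by rewrite /scalar_re /of_real; case: k. Qed.

Lemma of_real0 : of_real 0 = 0.
Proof. by rewrite /of_real; case: k. Qed.

Lemma of_real1 : of_real 1 = 1.
Proof. by rewrite /of_real; case: k. Qed.

Lemma of_realN r : of_real (- r) = - of_real r.
Proof. by rewrite /of_real; case: k => //=; rewrite rmorphN. Qed.

Lemma of_realD r s : of_real (r + s) = of_real r + of_real s.
Proof. by rewrite /of_real; case: k => //=; rewrite rmorphD. Qed.

Lemma of_realM r s : of_real (r * s) = of_real r * of_real s.
Proof. by rewrite /of_real; case: k => //=; rewrite rmorphM. Qed.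

Lemma scalar_re_ofM r z : re (of_real r * z) = r * re z.
Proof.
rewrite /scalar_re /of_real; case: k z => //= -[a b] /=.
by rewrite mul0r subr0.
Qed.

Lemma ler_of_real r s : (of_real r <= of_real s) = (r <= s).
Proof. by rewrite /of_real; case: k => //=; rewrite lecR. Qed.

Lemma ltr_of_real r s : (of_real r < of_real s) = (r < s).
Proof. by rewrite /of_real; case: k => //=; rewrite ltcR. Qed.

Lemma scalar_reK z : 0 <= z -> of_real (re z) = z.
Proof.
rewrite /scalar_re /of_real; case: k z => //= -[a b].
by rewrite lecE /= => /andP[/eqP -> _].
Qed.

Lemma scalar_re_ge0 z : 0 <= z -> 0 <= re z.
Proof. by move=> z0; rewrite -ler_of_real of_real0 scalar_reK. Qed.

Lemma scalar_re_gt0 z : 0 < z -> 0 < re z.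
Proof. by move=> z0; rewrite -ltr_of_real of_real0 scalar_reK// ltW. Qed.

Lemma scalar_conjK : involutive conj.
Proof.
rewrite /scalar_conj; case: k => //=; exact: Num.Theory.conjCK.
Qed.

Lemma scalar_re_conj z : re (conj z) = re z.
Proof. by rewrite /scalar_re /scalar_conj; case: k z => //= -[a b]. Qed.

(** This is how symmetry makes [inner (S x) x] real, a precondition for any use of the order of
    [R[i]], where comparable numbers have equal imaginary parts. *)
Lemma scalar_conj_fixed z : conj z = z -> of_real (re z) = z.
Proof.
rewrite /scalar_re /scalar_conj /of_real; case: k z => //= -[a b] /= [].
move/eqP; rewrite eq_sym -addr_eq0 -mulr2n mulrn_eq0/= => /eqP->.
by [].
Qed.

Lemma mul_scalar_conj z : z * conj z = `|z| ^+ 2.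
Proof.
rewrite /scalar_conj; case: k z => [z|z] /=; last by rewrite normCK.
by rewrite real_normK ?num_real// expr2.
Qed.

Lemma scalar_conj_of r : conj (of_real r) = of_real r.
Proof.
rewrite /scalar_conj /of_real; case: k => //=.
exact: conjc_real.
Qed.

Lemma scalar_re_le_norm z : re z <= re `|z|.
Proof.
rewrite /scalar_re; case: k z => [z|z] /=; first exact: ler_norm.
have := normc_ge_Re z; rewrite lecE /= => /andP[_]; apply: le_trans.
exact: ler_norm.
Qed.

End Scalars.

(** Real-valued, so that infima, square roots and [lra] are available whichever field [K] is. *)
Definition rnorm (R : realType) (k : scalar_kind)
  (V : normedZmodType (scalars R k)) (x : V) : R := scalar_re `|x|.
Arguments rnorm {R k V} x.

Section RealNorm.
Context {R : realType} {k : scalar_kind}.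
Local Notation K := (scalars R k).
Local Notation conj := (scalar_conj R k).
Implicit Types (V : normedZmodType K) (H : normedModType K) (z : K) (r : R).

Lemma of_rnorm V (x : V) : of_real (rnorm x) = `|x|.
Proof. by rewrite scalar_reK. Qed.

Lemma rnorm_ge0 V (x : V) : 0 <= rnorm x.
Proof. exact: scalar_re_ge0. Qed.

Lemma rnormD V (x y : V) : rnorm (x + y) <= rnorm x + rnorm y.
Proof. by rewrite -(@ler_of_real _ k) of_realD !of_rnorm ler_normD. Qed.

Lemma rnormN V (x : V) : rnorm (- x) = rnorm x.
Proof. by rewrite /rnorm normrN. Qed.

Lemma rnormB V (x y : V) : rnorm (x - y) = rnorm (y - x).
Proof. by rewrite /rnorm distrC. Qed.

Lemma rnorm_triangle V (y x z : V) :
  rnorm (x - z) <= rnorm (x - y) + rnorm (y - z).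
Proof. by rewrite -[x - z](subrKA y) rnormD. Qed.

Lemma rnorm0 V : rnorm (0 : V) = 0.
Proof. by rewrite /rnorm normr0 scalar_re0. Qed.

Lemma rnorm0_eq0 V (x : V) : rnorm x = 0 -> x = 0.
Proof. by move=> x0; apply/eqP; rewrite -normr_eq0 -of_rnorm x0 of_real0. Qed.

Lemma rnormZ H z (x : H) : rnorm (z *: x) = rnorm z * rnorm x.
Proof. by rewrite {1}/rnorm normrZ -of_rnorm scalar_re_ofM. Qed.

Lemma rnormM z w : rnorm (z * w : K) = rnorm z * rnorm w.
Proof. by rewrite {1}/rnorm normrM -of_rnorm scalar_re_ofM. Qed.

Lemma rnorm_real r : 0 <= r -> rnorm (of_real r : K) = r.
Proof.
by move=> r0; rewrite /rnorm ger0_norm ?of_realK// -of_real0 ler_of_real.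
Qed.

Lemma sqr_rnorm z : rnorm z ^+ 2 = scalar_re (z * conj z).
Proof. by rewrite mul_scalar_conj !expr2 -scalar_re_ofM of_rnorm. Qed.

Lemma rnorm_conj z : rnorm (conj z) = rnorm z.
Proof.
apply/eqP; rewrite -(@eqrXn2 _ 2%N) ?rnorm_ge0// !sqr_rnorm scalar_conjK.
by rewrite mulrC.
Qed.

Lemma scalar_re_rnorm z : scalar_re z <= rnorm z.
Proof. exact: scalar_re_le_norm. Qed.

(** The choice [a := conj z] gives [|z|^2]. It upgrades identities between real parts to identities
    in [K]. *)
Lemma scalar_re_all0 z : (forall a : K, scalar_re (a * z) = 0) -> z = 0.
Proof.
move=> /(_ (conj z)); rewrite mulrC -sqr_rnorm => /eqP.
by rewrite sqrf_eq0 => /eqP/rnorm0_eq0.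
Qed.

End RealNorm.

(** * Subspaces and operators that are linear only on a subspace *)

Section Subspace.
Context {K : numFieldType} {V : lmodType K} {D : set V}.
Hypothesis subD : linear_subspace D.

Lemma subspace0 : D 0. Proof. by case: subD. Qed.

Lemma subspaceD x y : D x -> D y -> D (x + y).
Proof. by case: subD => _ DP Dx /(DP 1 _ _ Dx); rewrite scale1r. Qed.

Lemma subspaceZ a x : D x -> D (a *: x).
Proof. by case: subD => D0 DP Dx; rewrite -[_ *: _]addr0; exact: DP. Qed.

Lemma subspaceN x : D x -> D (- x).
Proof. by rewrite -scaleN1r; exact: subspaceZ. Qed.

Lemma subspaceB x y : D x -> D y -> D (x - y).
Proof. by move=> Dx /subspaceN; exact: subspaceD. Qed.

End Subspace.

Section LinearOn.
Context {K : numFieldType} {V W : lmodType K} {D : set V} {T : V -> W}.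
Hypotheses (subD : linear_subspace D) (T_lin : linear_on D T).

Lemma linear_on0 : T 0 = 0.
Proof.
have := T_lin 1 (subspace0 subD) (subspace0 subD).
by rewrite !scale1r addr0 => /eqP; rewrite -subr_eq subrr eq_sym => /eqP.
Qed.

Lemma linear_onD x y : D x -> D y -> T (x + y) = T x + T y.
Proof. by move=> Dx Dy; rewrite -{1}[x]scale1r T_lin// scale1r. Qed.

Lemma linear_onZ a x : D x -> T (a *: x) = a *: T x.
Proof.
move=> Dx; rewrite -[a *: x]addr0 T_lin ?linear_on0 ?addr0//.
exact: subspace0.
Qed.

Lemma linear_onN x : D x -> T (- x) = - T x.
Proof. by move=> Dx; rewrite -scaleN1r linear_onZ// scaleN1r. Qed.

Lemma linear_onB x y : D x -> D y -> T (x - y) = T x - T y.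
Proof.
by move=> Dx Dy; rewrite linear_onD ?linear_onN//; exact: subspaceN.
Qed.

Lemma linear_subspace_image : linear_subspace (T @` D).
Proof.
split; first by exists 0; [exact: subspace0|rewrite linear_on0].
move=> a _ _ [x Dx <-] [y Dy <-]; exists (a *: x + y).
  by apply: subspaceD => //; exact: subspaceZ.
by rewrite T_lin.
Qed.

End LinearOn.

(** A semi-inner product on a subspace; nonzero null vectors are allowed, since [T] may have a
    kernel. One Cauchy-Schwarz inequality thus serves the inner product of [H], the energy on [D],
    the energy of the completion, and the forms of positive operators. *)
Record pos_form (R : realType) (k : scalar_kind) (V : lmodType (scalars R k))
    (D : set V) (b : V -> V -> scalars R k) : Prop := PosForm {
  pf_subspace : linear_subspace D;
  pf_linear : forall a x y z, D x -> D y -> D z ->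
    b (a *: x + y) z = a * b x z + b y z;
  pf_herm : forall x y, D x -> D y -> b y x = scalar_conj R k (b x y);
  pf_ge0 : forall x, D x -> 0 <= b x x }.

Definition form_norm (R : realType) (k : scalar_kind)
  (V : lmodType (scalars R k)) (b : V -> V -> scalars R k) (x : V) : R :=
  Num.sqrt (scalar_re (b x x)).

(** * Cauchy-Schwarz and the seminorm of a positive form *)

Section PosForm.
Context {R : realType} {k : scalar_kind} {V : lmodType (scalars R k)}.
Context {D : set V} {b : V -> V -> scalars R k}.
Hypothesis bP : pos_form D b.
Local Notation K := (scalars R k).
Local Notation conj := (scalar_conj R k).
Local Notation re := (@scalar_re R k).
Local Notation q := (form_norm b).
Local Notation subD := (pf_subspace bP).

Lemma pfDl x y z : D x -> D y -> D z -> b (x + y) z = b x z + b y z.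
Proof. by move=> *; rewrite -{1}[x]scale1r (pf_linear bP)// mul1r. Qed.

Lemma pf0l z : D z -> b 0 z = 0.
Proof.
move=> Dz; have D0 := subspace0 subD; have := pfDl D0 D0 Dz.
by rewrite addr0 => /eqP; rewrite -subr_eq subrr eq_sym => /eqP.
Qed.

Lemma pfZl a x z : D x -> D z -> b (a *: x) z = a * b x z.
Proof.
move=> Dx Dz; rewrite -[a *: x]addr0 (pf_linear bP)// ?pf0l ?addr0//.
exact: subspace0 subD.
Qed.

Lemma pfNl x z : D x -> D z -> b (- x) z = - b x z.
Proof. by move=> *; rewrite -scaleN1r pfZl// mulN1r. Qed.

Lemma pfBl x y z : D x -> D y -> D z -> b (x - y) z = b x z - b y z.
Proof.
by move=> *; rewrite pfDl ?pfNl//; exact: (subspaceN subD).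
Qed.

Lemma pfDr x y z : D x -> D y -> D z -> b z (x + y) = b z x + b z y.
Proof.
move=> Dx Dy Dz; rewrite (pf_herm bP (subspaceD subD Dx Dy) Dz) pfDl//.
by rewrite rmorphD -!(pf_herm bP).
Qed.

Lemma pfZr a x z : D x -> D z -> b z (a *: x) = conj a * b z x.
Proof.
move=> Dx Dz; rewrite (pf_herm bP (subspaceZ subD a Dx) Dz) pfZl//.
by rewrite rmorphM -(pf_herm bP).
Qed.

Lemma pfNr x z : D x -> D z -> b z (- x) = - b z x.
Proof. by move=> *; rewrite -scaleN1r pfZr// rmorphN1 mulN1r. Qed.

Lemma pfBr x y z : D x -> D y -> D z -> b z (x - y) = b z x - b z y.
Proof.
by move=> *; rewrite pfDr ?pfNr//; exact: (subspaceN subD).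
Qed.

Lemma form_norm_ge0 x : 0 <= q x.
Proof. exact: sqrtr_ge0. Qed.

Lemma sqr_form_norm x : D x -> q x ^+ 2 = re (b x x).
Proof. by move=> Dx; rewrite sqr_sqrtr// scalar_re_ge0// (pf_ge0 bP). Qed.

Lemma of_sqr_form_norm x : D x -> of_real (q x ^+ 2) = b x x.
Proof. by move=> Dx; rewrite sqr_form_norm// scalar_reK// (pf_ge0 bP). Qed.

Lemma re_formD x y : D x -> D y ->
  re (b (x + y) (x + y)) = re (b x x) + re (b y y) + 2 * re (b x y).
Proof.
move=> Dx Dy; have Dxy := subspaceD subD Dx Dy.
rewrite pfDl// !pfDr// (pf_herm bP Dx Dy) !scalar_reD scalar_re_conj.
by ring.
Qed.

(* Positivity of [b] at [(s * b x y) *: y + x] for every real [s] is a quadratic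
   inequality in [s] with discriminant [4 N^2 (N^2 - b x x * b y y)],
   where [N = |b x y|]. *)
Lemma form_CauchySchwarz x y : D x -> D y -> rnorm (b x y) <= q x * q y.
Proof.
move=> Dx Dy; rewrite -ler_sqr ?nnegrE ?rnorm_ge0 ?mulr_ge0 ?form_norm_ge0//.
rewrite exprMn !sqr_form_norm// sqr_rnorm.
set N := re _; set u := re _; set v := re _.
have N0 : 0 <= N by rewrite /N -sqr_rnorm sqr_ge0.
have u0 : 0 <= u by rewrite scalar_re_ge0// (pf_ge0 bP).
have v0 : 0 <= v by rewrite scalar_re_ge0// (pf_ge0 bP).
have quad s : 0 <= u + s ^+ 2 * N * v + 2 * (s * N).
  pose a := of_real s * b x y.
  have Day := subspaceZ subD a Dy.
  have := scalar_re_ge0 (pf_ge0 bP (subspaceD subD Dx Day)).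
  rewrite re_formD// !pfZl// !pfZr//.
  suff [-> ->] : re (a * (conj a * b y y)) = s ^+ 2 * N * v /\
      re (conj a * b x y) = s * N by [].
  rewrite /a rmorphM scalar_conj_of; split.
    rewrite -(scalar_reK (pf_ge0 bP Dy)) -/v.
    rewrite (_ : _ * _ = of_real (s * s * v) * (b x y * conj (b x y))).
      by rewrite scalar_re_ofM -/N; ring.
    by rewrite !of_realM; ring.
  by rewrite -mulrA scalar_re_ofM [_ * b x y]mulrC.
have [v00|v_neq0] := eqVneq v 0.
  have [->|N_neq0] := eqVneq N 0; first by rewrite mulr_ge0.
  (* [N] stands here for [|b x y|^2]. With [v = 0] the quadratic is affine of slope [2 * N], and
     this [s] gives it the value [-1]. *)
  have := quad (- (u + 1) / (2 * N)).
  rewrite v00 mulr0 addr0 (_ : 2 * _ = - (u + 1)); last by field.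
  by lra.
(* The minimiser of the quadratic when [v] and [N] are positive. *)
have := quad (- v^-1).
rewrite (_ : _ + _ = u - N / v); last by field.
by rewrite subr_ge0 ler_pdivrMr// lt_neqAle eq_sym v_neq0.
Qed.

Lemma form_normD x y : D x -> D y -> q (x + y) <= q x + q y.
Proof.
move=> Dx Dy; have Dxy := subspaceD subD Dx Dy.
rewrite -ler_sqr ?nnegrE ?addr_ge0 ?form_norm_ge0//.
rewrite sqr_form_norm// re_formD// -!sqr_form_norm// sqrrD.
have := le_trans (scalar_re_rnorm (b x y)) (form_CauchySchwarz Dx Dy).
by rewrite -mulr_natl; lra.
Qed.

Lemma form_normZ a x : D x -> q (a *: x) = rnorm a * q x.
Proof.
move=> Dx; have Dax := subspaceZ subD a Dx.
apply/eqP; rewrite -(@eqrXn2 _ 2%N) ?mulr_ge0 ?form_norm_ge0 ?rnorm_ge0//.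
rewrite exprMn !sqr_form_norm// pfZl// pfZr// mulrA.
by rewrite mul_scalar_conj -of_rnorm !expr2 -!of_realM scalar_re_ofM.
Qed.

Lemma form_normN x : D x -> q (- x) = q x.
Proof.
move=> Dx; rewrite -scaleN1r form_normZ// rnormN -of_real1 rnorm_real//.
by rewrite mul1r.
Qed.

Lemma form_normB x y : D x -> D y -> q (x - y) = q (y - x).
Proof.
by move=> Dx Dy; rewrite -opprB form_normN//; exact: (subspaceB subD).
Qed.

Lemma form_norm_triangle y x z : D x -> D y -> D z ->
  q (x - z) <= q (x - y) + q (y - z).
Proof.
move=> Dx Dy Dz; rewrite -[x - z](subrKA y).
by apply: form_normD; exact: (subspaceB subD).
Qed.

Lemma form_norm_le_add x y : D x -> D y -> q x <= q (x - y) + q y.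
Proof.
move=> Dx Dy; rewrite -{1}(subrK y x).
by apply: form_normD => //; exact: (subspaceB subD).
Qed.

End PosForm.

(** Stated for a bare function [q], so that it can be proved for a form norm on a subspace before
    that subspace carries a topology of its own. *)
Definition seq_complete (R : realType) (V : zmodType) (D : set V)
    (q : V -> R) :=
  forall u : nat -> V, (forall n, D (u n)) ->
    (forall e : R, 0 < e -> exists N, forall m n, (N <= m)%N -> (N <= n)%N ->
       q (u m - u n) <= e) ->
  exists2 x, D x & forall e : R, 0 < e -> exists N, forall n, (N <= n)%N ->
       q (u n - x) <= e.

Lemma archi_inv (R : realType) (e : R) :
  0 < e -> exists N, forall n, (N <= n)%N -> n.+1%:R^-1 <= e.
Proof.
move=> e0; exists (Num.truncn e^-1) => n Nn.
rewrite -[leRHS]invrK lef_pV2 ?posrE ?invr_gt0// ltW//.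
by rewrite (lt_le_trans (truncnS_gt _))// ler_nat ltnS.
Qed.

(** * Sequential completeness of normed spaces and of the scalars *)

Section NormedSequences.
Context {R : realType} {k : scalar_kind}.
Local Notation K := (scalars R k).

Lemma cvg_rnormP (V : normedModType K) (u : nat -> V) (x : V) :
  u @ \oo --> x <-> forall e : R, 0 < e ->
    exists N, forall n, (N <= n)%N -> rnorm (u n - x) <= e.
Proof.
split=> [/cvgrPdist_le ux e e0|ux].
  have /ux[N _ uN] : (0 : K) < of_real e by rewrite -of_real0 ltr_of_real.
  by exists N => n /uN /=; rewrite -of_rnorm ler_of_real rnormB.
apply/cvgrPdist_le => e e0; have [N uN] := ux _ (scalar_re_gt0 e0).
exists N => // n /= /uN; rewrite rnormB -(@ler_of_real _ k) of_rnorm.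
by rewrite scalar_reK// ltW.
Qed.

Lemma normed_seq_complete (V : completeNormedModType K) :
  seq_complete [set: V] rnorm.
Proof.
move=> u _ ucauchy.
have /cauchy_cvg : cauchy (u @ \oo).
  apply: cauchy_exP => e e0; have e0R := scalar_re_gt0 e0.
  have [|N uN] := ucauchy (scalar_re e / 2); first by rewrite divr_gt0.
  exists (u N); exists N => // n /= Nn.
  rewrite /= -ball_normE /= -of_rnorm -(scalar_reK (ltW e0)) ltr_of_real.
  apply: le_lt_trans (uN N n _ Nn) _ => //.
  by rewrite ltr_pdivrMr// ltr_pMr ?ltr1n.
by move=> /cvg_ex[x /cvg_rnormP ux]; exists x.
Qed.

End NormedSequences.

(** Provides the limits in [K] that define the energy form. In [R[i]] the modulus dominates both
    coordinates and is dominated by the sum of their absolute values, so completeness is inherited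
    from [R]. *)
Lemma scalars_seq_complete (R : realType) (k : scalar_kind) :
  seq_complete [set: scalars R k] rnorm.
Proof.
have R_complete := @normed_seq_complete R RealScalars R.
case: k => [|u _ cu]; first exact: R_complete.
have norm_ge (z : R[i]) : [/\ `|complex.Re z| <= complex.Re `|z| &
    `|complex.Im z| <= complex.Re `|z|].
  case: z => a b; rewrite normc_def /=.
  by split; rewrite -sqrtr_sqr; apply: ler_wsqrtr;
    rewrite ?lerDl ?lerDr sqr_ge0.
have norm_le (z : R[i]) :
    complex.Re `|z| <= `|complex.Re z| + `|complex.Im z|.
  case: z => a b; rewrite normc_def /= -[leRHS]ger0_norm ?addr_ge0//.
  rewrite -sqrtr_sqr; apply: ler_wsqrtr.
  rewrite sqrrD !real_normK ?num_real//.
  by rewrite addrAC lerDl mulrn_wge0// mulr_ge0.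
have [//| |a _ ua] := R_complete (fun n => complex.Re (u n)).
  move=> e /cu[N uN]; exists N => m n Nm Nn; apply: le_trans (uN m n Nm Nn).
  by have [] := norm_ge (u m - u n); case: (u m) (u n) => ? ? [].
have [//| |b _ ub] := R_complete (fun n => complex.Im (u n)).
  move=> e /cu[N uN]; exists N => m n Nm Nn; apply: le_trans (uN m n Nm Nn).
  by have [_] := norm_ge (u m - u n); case: (u m) (u n) => ? ? [].
exists (a +i* b)%C => // e e0.
have e20 : 0 < e / 2 by rewrite divr_gt0.
have [N Na] := ua _ e20; have [M Mb] := ub _ e20.
exists (maxn N M) => n; rewrite geq_max => /andP[/Na na /Mb mb].
apply: le_trans (norm_le _) _; rewrite [e]splitr.
by case: (u n) na mb => ? ? na mb; exact: lerD na mb.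
Qed.

(** * The inner product of a Hilbert space as a positive form *)

Section InnerProduct.
Context {R : realType} {k : scalar_kind} {H : hilbertType R k}.
Local Notation K := (scalars R k).
Local Notation conj := (scalar_conj R k).
Local Notation re := (@scalar_re R k).
Implicit Types (x y z : H) (a : K).

Lemma linear_subspaceT : linear_subspace [set: H].
Proof. by split. Qed.

Lemma inner_pos : pos_form [set: H] (@inner R k H).
Proof.
split => [|a x y z _ _ _|x y _ _|x _].
- exact: linear_subspaceT.
- exact: linearPl.
- by rewrite hermC expr0 mul1r.
- by rewrite inner_normE exprn_ge0.
Qed.

Lemma innerDl x y z : inner (x + y) z = inner x z + inner y z.
Proof. exact: (pfDl inner_pos). Qed.

Lemma innerDr x y z : inner z (x + y) = inner z x + inner z y.
Proof. exact: (pfDr inner_pos). Qed.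

Lemma innerBl x y z : inner (x - y) z = inner x z - inner y z.
Proof. exact: (pfBl inner_pos). Qed.

Lemma innerBr x y z : inner z (x - y) = inner z x - inner z y.
Proof. exact: (pfBr inner_pos). Qed.

Lemma innerZl a x z : inner (a *: x) z = a * inner x z.
Proof. exact: (pfZl inner_pos). Qed.

Lemma innerZr a x z : inner z (a *: x) = conj a * inner z x.
Proof. exact: (pfZr inner_pos). Qed.

Lemma innerC x y : inner y x = conj (inner x y).
Proof. exact: (pf_herm inner_pos). Qed.

Lemma form_norm_inner x : form_norm inner x = rnorm x.
Proof.
rewrite /form_norm inner_normE -of_rnorm expr2 -of_realM of_realK -expr2.
by rewrite sqrtr_sqr ger0_norm// rnorm_ge0.
Qed.

Lemma inner_CauchySchwarz x y : rnorm (inner x y) <= rnorm x * rnorm y.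
Proof. by rewrite -!form_norm_inner (form_CauchySchwarz inner_pos). Qed.

Lemma re_inner x : re (inner x x) = rnorm x ^+ 2.
Proof. by rewrite -(sqr_form_norm inner_pos)// form_norm_inner. Qed.

Lemma inner_rnorm x : inner x x = of_real (rnorm x ^+ 2).
Proof. by rewrite -form_norm_inner (of_sqr_form_norm inner_pos). Qed.

Lemma innerI x y : (forall z, inner x z = inner y z) -> x = y.
Proof.
move=> xy; apply/eqP; rewrite -subr_eq0; apply/eqP/rnorm0_eq0/eqP.
by rewrite -sqrf_eq0 -re_inner innerBl xy subrr scalar_re0.
Qed.

End InnerProduct.

(** The form is independent of any norm on [V]. Bundling the data lets all the structures be
    attached to the single type [hs_type s]. *)
Record hspace (R : realType) (k : scalar_kind) (V : lmodType (scalars R k)) :=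
  HSpace {
  hs_set : set V;
  hs_form : V -> V -> scalars R k;
  hs_pos : pos_form hs_set hs_form;
  hs_definite : forall x, hs_set x -> hs_form x x = 0 -> x = 0;
  hs_complete : seq_complete hs_set (form_norm hs_form) }.

(** * From a complete definite form on a subspace to a Hilbert space *)

Section HilbertOfForm.
Context {R : realType} {k : scalar_kind} {V : lmodType (scalars R k)}.
Variable s : hspace V.
Local Notation K := (scalars R k).
Local Notation conj := (scalar_conj R k).
Local Notation re := (@scalar_re R k).

Definition hs_pred : {pred V} := fun x => `[< hs_set s x >].

Lemma hs_predP x : reflect (hs_set s x) (x \in hs_pred).
Proof. exact: asboolP. Qed.

Lemma hs_submod_closed : submod_closed hs_pred.
Proof.
have subD := pf_subspace (hs_pos s).
split=> [|a x y /hs_predP Dx /hs_predP Dy]; apply/hs_predP.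
  exact: subspace0.
by apply: subspaceD => //; exact: subspaceZ.
Qed.

HB.instance Definition _ := GRing.isSubmodClosed.Build K V hs_pred
  hs_submod_closed.

Definition hs_type := {x : V | x \in hs_pred}.
HB.instance Definition _ := SubChoice.on hs_type.
HB.instance Definition _ := [SubChoice_isSubLmodule of hs_type by <:].

Lemma hs_valP (x : hs_type) : hs_set s (val x).
Proof. exact/hs_predP/valP. Qed.

Definition hs_norm (x : hs_type) : K := of_real (form_norm (hs_form s) (val x)).

Lemma hs_normD x y : hs_norm (x + y) <= hs_norm x + hs_norm y.
Proof.
rewrite -of_realD ler_of_real raddfD.
by apply: (form_normD (hs_pos s)); exact: hs_valP.
Qed.

Lemma hs_normZ a x : hs_norm (a *: x) = `|a| * hs_norm x.
Proof.
rewrite /hs_norm linearZ /= (form_normZ (hs_pos s)) ?of_realM ?of_rnorm//.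
exact: hs_valP.
Qed.

Lemma hs_norm_eq0 x : hs_norm x = 0 -> x = 0.
Proof.
rewrite -of_real0 => /(congr1 re); rewrite !of_realK => x0.
apply/val_inj/(hs_definite (hs_valP x)).
by rewrite -(of_sqr_form_norm (hs_pos s) (hs_valP x)) x0 expr0n of_real0.
Qed.

HB.instance Definition _ := Lmodule_isNormed.Build K hs_type
  hs_normD hs_normZ hs_norm_eq0.

Lemma rnorm_hs (x : hs_type) : rnorm x = form_norm (hs_form s) (val x).
Proof. by rewrite /rnorm of_realK. Qed.

Lemma rnorm_hsB (x y : hs_type) :
  rnorm (x - y) = form_norm (hs_form s) (val x - val y).
Proof. by rewrite rnorm_hs raddfB. Qed.

(** From sequences to filters: choose centres [u n] of balls of radius [1 / (n + 1)] belonging to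
    [F]. Two such balls meet, so [u] is Cauchy, and [F] converges to its limit. *)
Lemma hs_cauchy_cvg (F : set_system hs_type) :
  ProperFilter F -> cauchy F -> cvg F.
Proof.
move=> FF /cauchyP cF.
have K0 (e : R) : 0 < e -> (0 : K) < of_real e by rewrite -of_real0 ltr_of_real.
have {}cF n : exists x : hs_type, F (ball x (of_real n.+1%:R^-1 : K)).
  by apply/cF/K0; rewrite invr_gt0.
have [u Fu] := choice cF.
have [| |x Dx ux] := @hs_complete _ _ _ s (val \o u).
- by move=> n; exact: hs_valP.
- move=> e e0; have [N Ne] := archi_inv (divr_gt0 e0 (ltr0Sn _ 1)).
  exists N => m n /Ne me /Ne ne.
  have [z []] := filter_ex (filterI (Fu m) (Fu n)).
  rewrite -!ball_normE /= -!of_rnorm !ltr_of_real => umz unz.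
  rewrite -[leLHS]rnorm_hsB; apply: le_trans (rnorm_triangle z _ _) _.
  rewrite [rnorm (z - _)]rnormB; apply: le_trans (lerD (ltW umz) (ltW unz)) _.
  by rewrite [e]splitr lerD.
- pose y : hs_type := Sub x (introT (hs_predP x) Dx).
  apply/cvg_ex; exists y; apply/cvgrPdist_lt => /= e e0.
  have e20 : 0 < re e / 2 by rewrite divr_gt0 ?scalar_re_gt0.
  have [N Ne] := archi_inv e20; have [M Me] := ux _ e20.
  pose n := maxn N M.
  apply: filterS (Fu n) => z.
  rewrite -ball_normE /= -of_rnorm ltr_of_real => unz.
  rewrite -of_rnorm -(scalar_reK (ltW e0)) ltr_of_real.
  have := Me n (leq_maxr _ _); have := Ne n (leq_maxl _ _).
  rewrite -[form_norm _ _](rnorm_hsB _ y).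
  move=> Nn Mn; apply: le_lt_trans (rnorm_triangle (u n) y z) _.
  by rewrite [ltRHS]splitr ler_ltD ?(lt_le_trans unz)// rnormB.
Qed.

HB.instance Definition _ := Uniform_isComplete.Build hs_type hs_cauchy_cvg.

Definition hs_inner (x y : hs_type) : K := hs_form s (val x) (val y).

Lemma hs_inner_bilinear : bilinear_for
  (GRing.Scale.Law.clone _ _ ( *%R ) _)
  (GRing.Scale.Law.clone _ _ (conj \; *%R) _)
  hs_inner.
Proof.
have bP := hs_pos s.
split=> [z a x y|z a x y] /=; rewrite /hs_inner linearP /=.
  by rewrite (pf_linear bP)//; exact: hs_valP.
rewrite (pfDr bP) ?(pfZr bP)//; try exact: hs_valP.
by apply: subspaceZ (pf_subspace bP) _ _ _; exact: hs_valP.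
Qed.

HB.instance Definition _ := bilinear_isBilinear.Build K hs_type hs_type K _ _
  hs_inner hs_inner_bilinear.

Lemma hs_inner_herm x y : hs_inner x y = (-1) ^+ false * conj (hs_inner y x).
Proof. by rewrite expr0 mul1r; apply: (pf_herm (hs_pos s)); exact: hs_valP. Qed.

HB.instance Definition _ := isHermitianSesquilinear.Build K hs_type false conj
  hs_inner hs_inner_herm.

Lemma hs_innerE (x : hs_type) : hs_inner x x = `|x| ^+ 2.
Proof.
rewrite -of_rnorm expr2 -of_realM -expr2 rnorm_hs.
by rewrite (of_sqr_form_norm (hs_pos s))//; exact: hs_valP.
Qed.

Lemma hs_inner_gt0 x : x != 0 -> 0 < hs_inner x x.
Proof. by move=> x0; rewrite hs_innerE exprn_gt0 ?normr_gt0. Qed.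

HB.instance Definition _ := isDotProduct.Build K hs_type hs_inner hs_inner_gt0.

HB.instance Definition _ := @isHilbert.Build R k hs_type
  (hs_inner : {dot hs_type for conj}) hs_innerE.

Lemma inner_hs (x y : hs_type) : inner x y = hs_form s (val x) (val y).
Proof. by []. Qed.

End HilbertOfForm.

(** The form in which limits are taken in inequalities below. The restriction [e <= 1] lets an error
    [e ^ 2] be absorbed into a linear one. *)
Lemma le_of_small (R : realType) (M x y : R) : 0 <= M ->
  (forall e : R, 0 < e -> e <= 1 -> x <= y + M * e) -> x <= y.
Proof.
move=> M0 xy; apply/ler_addgt0Pr => e e0.
have M10 : 0 < M + 1 by rewrite ltr_wpDl.
have d0 : 0 < Num.min 1 (e / (M + 1)) by rewrite lt_min ltr01 divr_gt0.
apply: le_trans (xy _ d0 _) _; rewrite ?ge_min ?lexx// lerD2l.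
apply: le_trans (ler_wpM2l M0 (_ : _ <= e / (M + 1))) _.
  by rewrite ge_min lexx orbT.
by rewrite mulrCA ger_pMr// ler_pdivrMr// mul1r lerDl.
Qed.

(** * Riesz representation for a functional controlled through a map [iota] into [E] *)

Section Riesz.
Context {R : realType} {k : scalar_kind} {E : hilbertType R k}.
Local Notation K := (scalars R k).
Local Notation re := (@scalar_re R k).

Lemma sqr_rnormD (x y : E) :
  rnorm (x + y) ^+ 2 = rnorm x ^+ 2 + rnorm y ^+ 2 + 2 * re (inner x y).
Proof. by rewrite -!re_inner (re_formD inner_pos). Qed.

Lemma sqr_rnormB (x y : E) :
  rnorm (x - y) ^+ 2 = rnorm x ^+ 2 + rnorm y ^+ 2 - 2 * re (inner x y).
Proof.
by rewrite sqr_rnormD rnormN (pfNr inner_pos)// scalar_reN mulrN.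
Qed.

Lemma sqr_rnormZ_real (r : R) (x : E) :
  rnorm (of_real r *: x) ^+ 2 = r ^+ 2 * rnorm x ^+ 2.
Proof.
rewrite rnormZ exprMn sqr_rnorm scalar_conj_of -of_realM of_realK.
by rewrite -expr2.
Qed.

Variables (X : lmodType K) (W : set X) (iota : X -> E) (phi : X -> K^o) (C : R).
Hypotheses (subW : linear_subspace W) (iota_lin : linear_on W iota).
Hypotheses (phi_lin : linear_on W phi).
Hypothesis phi_bounded : forall w, W w ->
  rnorm (phi w : K) <= C * rnorm (iota w).

(** If [e] represents [phi], then [J w = |iota w - e|^2 - |e|^2], so minimising [J] means
    approaching [e]. Working over [W] covers both later uses: [iota] from [ran T] into the
    completion, and the identity of [H]. *)
Let J w := rnorm (iota w) ^+ 2 - 2 * re (phi w).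
Let m := inf [set J w | w in W].

Lemma riesz_functional_has_inf : has_inf [set J w | w in W].
Proof.
split; first by exists (J 0), 0 => //; exact: subspace0.
(* With [t = |iota w|], [J w >= t^2 - 2 C t = (t - C)^2 - C^2]. *)
exists (- C ^+ 2) => _ [w Ww <-]; rewrite /J.
have := le_trans (scalar_re_rnorm _) (phi_bounded Ww).
have := sqr_ge0 (rnorm (iota w) - C); rewrite sqrrB -mulr_natl; lra.
Qed.

Lemma riesz_functional_ge w : W w -> m <= J w.
Proof.
move=> Ww; apply: ge_inf; last by exists w.
exact: (riesz_functional_has_inf).2.
Qed.

(** By the parallelogram law the left side is [2 J x + 2 J y - 4 J ((x + y) / 2)], the terms in
    [phi] cancelling; the midpoint has [J] at least [m]. *)
Lemma riesz_parallelogram x y : W x -> W y ->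
  rnorm (iota x - iota y) ^+ 2 <= 2 * (J x - m) + 2 * (J y - m).
Proof.
move=> Wx Wy; pose h : K := of_real 2^-1.
have Wxy := subspaceD subW Wx Wy.
have := riesz_functional_ge (subspaceZ subW h Wxy).
rewrite /J (linear_onZ subW iota_lin)// (linear_onZ subW phi_lin)//.
rewrite (linear_onD iota_lin)// (linear_onD phi_lin)//.
rewrite sqr_rnormZ_real /h [_ *: _]/(_ * _) scalar_re_ofM scalar_reD.
rewrite (sqr_rnormD (iota x) (iota y)) sqr_rnormB exprVn; lra.
Qed.

(** [J (x + s w) >= m] expanded. The infimum need not be attained on [W], so the excess [J x - m] is
    carried along. *)
Lemma riesz_variation x w (s : R) : W x -> W w ->
  0 <= J x - m + 2 * s * (re (inner (iota x) (iota w)) - re (phi w)) +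
       s ^+ 2 * rnorm (iota w) ^+ 2.
Proof.
move=> Wx Ww; have Wsw := subspaceZ subW (of_real s) Ww.
have := riesz_functional_ge (subspaceD subW Wx Wsw).
rewrite /J (linear_onD iota_lin)// (linear_onD phi_lin)//.
rewrite (linear_onZ subW iota_lin)// (linear_onZ subW phi_lin)//.
rewrite sqr_rnormD sqr_rnormZ_real innerZr scalar_conj_of.
by rewrite [_ *: _]/(_ * _) scalar_reD !scalar_re_ofM; lra.
Qed.

(* The representing vector is the limit of the images of a minimising sequence
   of [J]; its Euler equation gives [Re (phi w) = Re <iota w, e>], and replacing
   [w] by [a *: w] gives the rest. *)
Lemma riesz : exists e, forall w, W w -> phi w = inner (iota w) e.
Proof.
have minseq n : exists x, W x /\ J x - m <= n.+1%:R^-1.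
  have n0 : 0 < n.+1%:R^-1 :> R by rewrite invr_gt0.
  have [_ [w Ww <-] /ltW wn] := inf_adherent n0 riesz_functional_has_inf.
  by exists w; split => //; rewrite lerBlDl.
have [u Wu] := choice minseq.
have [//| |e _ ue] := @normed_seq_complete _ _ E (iota \o u).
  move=> e e0; have e40 : 0 < e ^+ 2 / 4 by rewrite divr_gt0 ?exprn_gt0.
  have [N Ne] := archi_inv e40; exists N => i j /Ne Ni /Ne Nj /=.
  rewrite -ler_sqr ?nnegrE ?rnorm_ge0 ?(ltW e0)//.
  apply: le_trans (riesz_parallelogram (Wu i).1 (Wu j).1) _.
  have := le_trans (Wu i).2 Ni; have := le_trans (Wu j).2 Nj; lra.
have re_eq w : W w -> re (phi w) = re (inner (iota w) e).
  move=> Ww; rewrite [inner _ e]innerC scalar_re_conj; apply/eqP.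
  rewrite eq_sym -subr_eq0; set d := _ - _; set c := rnorm (iota w) ^+ 2.
  have c0 : 0 <= c by rewrite sqr_ge0.
  have quad (s : R) : 0 <= 2 * s * d + s ^+ 2 * c.
    (* The excess of [u n] costs [eta]; replacing [iota (u n)] by its limit [e] costs
       [2 * |s| * eta * |iota w|]. *)
    apply: (@le_of_small _ (1 + 2 * `|s| * rnorm (iota w))).
      by rewrite addr_ge0// !mulr_ge0// rnorm_ge0.
    move=> eta eta0 _.
    have [N Neta] := archi_inv eta0; have [M Meta] := ue _ eta0.
    pose n := maxn N M.
    have := riesz_variation s (Wu n).1 Ww; rewrite -/c.
    have := le_trans (Wu n).2 (Neta n (leq_maxl _ _)).
    have near : `|re (inner (iota (u n)) (iota w)) - re (inner e (iota w))|
        <= eta * rnorm (iota w).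
      rewrite -scalar_reB -innerBl.
      have le1 z : rnorm z <= eta ->
          re (inner z (iota w)) <= eta * rnorm (iota w).
        move=> z1; apply: le_trans (scalar_re_rnorm _) _.
        apply: le_trans (inner_CauchySchwarz _ _) _.
        by rewrite ler_wpM2r ?rnorm_ge0.
      have := Meta n (leq_maxr _ _) => /= un.
      rewrite ler_norml le1// lerNl -scalar_reN -(pfNl inner_pos)//.
      by rewrite le1// rnormN.
    have : s * (re (inner (iota (u n)) (iota w)) - re (inner e (iota w)))
        <= `|s| * (eta * rnorm (iota w)).
      by apply: le_trans (ler_norm _) _; rewrite normrM ler_wpM2l.
    rewrite /d; lra.
  (* The minimiser would be [- d / c], but [c] may vanish; with [c + 1] the value is still negative
     unless [d = 0]. *)
  have := quad (- d / (c + 1)).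
  have c1 : c + 1 != 0 by lra.
  rewrite (_ : _ + _ = - (d ^+ 2 * ((c + 2) / (c + 1) ^+ 2))); last by field.
  rewrite oppr_ge0 pmulr_lle0 ?divr_gt0 ?exprn_gt0//; last 2 first.
  - by lra.
  - by lra.
  by move=> d2; rewrite -sqrf_eq0 eq_le d2 sqr_ge0.
exists e => w Ww; apply/eqP; rewrite -subr_eq0; apply/eqP/scalar_re_all0 => a.
rewrite mulrBr -innerZl -(linear_onZ subW iota_lin)// scalar_reB.
by rewrite -re_eq ?(linear_onZ subW phi_lin) ?subrr//; exact: subspaceZ.
Qed.

End Riesz.

(** * Testing vectors against a dense set *)

Section Density.
Context {R : realType} {k : scalar_kind} {E : hilbertType R k}.
Local Notation K := (scalars R k).
Implicit Types (S : set E).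

Lemma denseP_rnorm S :
  dense S <-> forall (x : E) (e : R), 0 < e ->
    exists2 y, S y & rnorm (x - y) <= e.
Proof.
split=> [dS x e e0|dS O [x Ox] oO].
  have e0K : (0 : K) < of_real e by rewrite -of_real0 ltr_of_real.
  have [] := dS (ball x (of_real e : K)).
  - by exists x; exact: ballxx.
  - exact: ball_open.
  move=> y []; rewrite -ball_normE /= -of_rnorm ltr_of_real => /ltW xy Sy.
  by exists y.
have /nbhs_ballP[e /= e0 xeO] : nbhs x O by exact: open_nbhs_nbhs.
have e20 : 0 < scalar_re e / 2 by rewrite divr_gt0 ?scalar_re_gt0.
have [y Sy xy] := dS x _ e20; exists y; split => //; apply: xeO.
rewrite -ball_normE /= -of_rnorm -(scalar_reK (ltW e0)) ltr_of_real.
by rewrite (le_lt_trans xy)// ltr_pdivrMr// ltr_pMr ?scalar_re_gt0// ltr1n.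
Qed.

(** For [y] in [S] within [e] of [x], [|x|^2 = Re <y, x> + Re <x - y, x>] is at most
    [M (|x| + e) + e |x|]; let [e] tend to [0] and divide by [|x|]. *)
Lemma dense_rnorm_le S (x : E) (M : R) : dense S -> 0 <= M ->
  (forall y, S y -> rnorm (inner y x) <= M * rnorm y) -> rnorm x <= M.
Proof.
move=> /denseP_rnorm dS M0 xM.
have [->|x0] := eqVneq (rnorm x) 0; first by [].
have {}x0 : 0 < rnorm x by rewrite lt_neqAle eq_sym x0 rnorm_ge0.
rewrite -(ler_pM2r x0) -expr2 -re_inner.
apply: (@le_of_small _ (M + rnorm x)) => [|e e0 _].
  by rewrite addr_ge0 ?rnorm_ge0.
have [y Sy xy] := dS x _ e0.
rewrite -{1}(subrK y x) innerDl scalar_reD.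
have := le_trans (scalar_re_rnorm _) (inner_CauchySchwarz (x - y) x).
have := le_trans (scalar_re_rnorm _) (xM _ Sy).
have : rnorm y <= rnorm x + e.
  rewrite -[y in leLHS](subrK x) addrC (le_trans (rnormD _ _))// lerD2l.
  by rewrite rnormB.
have := ler_wpM2r (rnorm_ge0 x) xy.
by move=> h1 /(ler_wpM2l M0) h2 h3 h4; lra.
Qed.

Lemma dense_innerI S (x y : E) : dense S ->
  (forall z, S z -> inner z x = inner z y) -> x = y.
Proof.
move=> dS xy; apply/eqP; rewrite -subr_eq0; apply/eqP/rnorm0_eq0/eqP.
rewrite eq_le rnorm_ge0 andbT; apply: (dense_rnorm_le dS) => // z Sz.
by rewrite innerBr xy// subrr rnorm0 mul0r.
Qed.

End Density.

(** * The operators [J^*] and [J^** J^*] for an arbitrary completion *)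

Section EnergyCompletion.
Context {R : realType} {k : scalar_kind} {H : hilbertType R k}.
Variables (D : set H) (T : H -> H) (E : hilbertType R k) (iota : H -> E).
Local Notation K := (scalars R k).
Local Notation energy := (fun f g => inner (T f) g).
Hypotheses (T_lin : linear_on D T) (T_pos : pos_form D energy).
Hypothesis compl : energy_completion D T iota.

Local Notation subD := (pf_subspace T_pos).
Local Notation J := (energy_map D T iota).

Let subTD : linear_subspace (T @` D).
Proof. exact: (linear_subspace_image subD T_lin). Qed.

Let iota_lin : linear_on (T @` D) iota. Proof. by case: compl. Qed.
Let iota_dense : dense (iota @` (T @` D)). Proof. by case: compl. Qed.
Let iota_inner f h : D f -> D h ->
  inner (iota (T f)) (iota (T h)) = inner (T f) h.
Proof. by case: compl => _ + _; exact. Qed.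

Lemma rnorm_iota f : D f -> rnorm (iota (T f)) = form_norm energy f.
Proof. by move=> Df; rewrite -form_norm_inner /form_norm iota_inner. Qed.

Lemma adjoint_energyP h e :
  adjoint J (h, e) <-> forall f, D f -> inner (T f) h = inner (iota (T f)) e.
Proof.
split=> [Jhe f Df|Jhe _ [_ [f Df <-] <-]]; last exact: Jhe.
by apply: (Jhe (iota (T f), T f)); exists (T f) => //; exists f.
Qed.

(** [J^*] is single-valued because the domain of [J] is dense. *)
Lemma adjoint_energy_inj h e e' :
  adjoint J (h, e) -> adjoint J (h, e') -> e = e'.
Proof.
move=> /adjoint_energyP he /adjoint_energyP he'.
apply: (dense_innerI iota_dense) => _ [_ [f Df <-] <-].
by rewrite -he// -he'.
Qed.

Lemma adjoint_energy_rnorm_le h e (M : R) : adjoint J (h, e) -> 0 <= M ->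
  (forall f, D f -> rnorm (inner (T f) h) <= M * form_norm energy f) ->
  rnorm e <= M.
Proof.
move=> /adjoint_energyP he M0 hM; apply: (dense_rnorm_le iota_dense M0).
by move=> _ [_ [f Df <-] <-]; rewrite -he// rnorm_iota// hM.
Qed.

(** [J] sends [iota (T h)] back to [T h], which is why [J^** J^*] extends [T]. *)
Lemma adjoint_energy_on h : D h -> adjoint J (h, iota (T h)).
Proof. by move=> Dh; apply/adjoint_energyP => f Df; rewrite iota_inner. Qed.

Variable c : R.
Hypothesis c0 : 0 <= c.
Hypothesis T_bounded : forall f, D f -> rnorm (T f) <= c * form_norm energy f.

(** Riesz applies since [|<T f, h>| <= |T f| |h| <= c |h| |iota (T f)|]. *)
Lemma adjoint_energy_ex h : exists e, adjoint J (h, e).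
Proof.
have [] := @riesz R k E H (T @` D) iota (fun y => inner y h) (c * rnorm h).
- exact: subTD.
- exact: iota_lin.
- by move=> a x y _ _; rewrite (pf_linear inner_pos).
- move=> _ [f Df <-]; rewrite rnorm_iota// mulrAC.
  apply: le_trans (inner_CauchySchwarz _ _) _.
  by rewrite ler_wpM2r ?rnorm_ge0// T_bounded.
- move=> e he; exists e; apply/adjoint_energyP => f Df.
  by apply: he; exists f.
Qed.

(** [J^*] is a total linear map bounded by [c], so Riesz on [H] itself makes its adjoint [J^**]
    total as well; since [J^*] is everywhere defined, [J^**] is also single-valued. *)
Lemma krein_neumann_ex : exists A,
  graph setT A = comp_graph (adjoint (adjoint J)) (adjoint J).
Proof.
have [Js JsP] := choice adjoint_energy_ex.
have Js_lin : linear_on setT Js.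
  move=> a x y _ _; apply: (adjoint_energy_inj (JsP _)).
  apply/adjoint_energyP => f Df; rewrite !innerDr !innerZr.
  have /adjoint_energyP/(_ _ Df)-> := JsP x.
  by have /adjoint_energyP/(_ _ Df)-> := JsP y.
have Js_bounded h : rnorm (Js h) <= c * rnorm h.
  apply: (adjoint_energy_rnorm_le (JsP h)) => [|f Df].
    by rewrite mulr_ge0 ?rnorm_ge0.
  rewrite mulrAC; apply: le_trans (inner_CauchySchwarz _ _) _.
  by rewrite ler_wpM2r ?rnorm_ge0// T_bounded.
have Jss_ex e : exists g, adjoint (adjoint J) (e, g).
  have [] := @riesz R k H H setT id (fun h => inner (Js h) e) (c * rnorm e).
  - exact: linear_subspaceT.
  - by [].
  - by move=> a x y _ _; rewrite Js_lin// (pf_linear inner_pos).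
  - move=> h _; apply: le_trans (inner_CauchySchwarz _ _) _.
    by rewrite mulrAC ler_wpM2r ?rnorm_ge0.
  - move=> g eg; exists g => -[h e'] he' /=.
    by rewrite (adjoint_energy_inj he' (JsP h)) eg.
have [Jss JssP] := choice Jss_ex.
exists (Jss \o Js); apply/seteqP; split=> [_ [h _ <-]|[h g] [e /= he eg]].
  by exists (Js h); [exact: JsP|exact: JssP].
exists h => //=; congr pair; rewrite (adjoint_energy_inj he (JsP h)) in eg.
apply: innerI => z; rewrite innerC [RHS]innerC; congr (scalar_conj R k _).
by rewrite -(JssP _ _ (JsP z)) -(eg _ (JsP z)).
Qed.

Variable A : H -> H.
Hypothesis A_graph :
  graph setT A = comp_graph (adjoint (adjoint J)) (adjoint J).

Lemma krein_neumann_factor g h : exists2 e, adjoint J (g, e) &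
  exists2 e', adjoint J (h, e') & inner g (A h) = inner e e'.
Proof.
have [e ge] := adjoint_energy_ex g; exists e => //.
have [e' /= he' eA] : comp_graph (adjoint (adjoint J)) (adjoint J) (h, A h).
  by rewrite -A_graph; exists h.
by exists e' => //; rewrite -(eA _ ge).
Qed.

Lemma krein_neumann_sym g h : inner (A g) h = inner g (A h).
Proof.
have [e ge [e' he' ->]] := krein_neumann_factor g h.
have [f hf [f' gf']] := krein_neumann_factor h g.
rewrite (adjoint_energy_inj hf he') (adjoint_energy_inj gf' ge) => hg.
by rewrite innerC hg -innerC.
Qed.

Lemma krein_neumann_extends : extends D T A.
Proof.
move=> f Df; have : graph setT A (f, T f).
  rewrite A_graph; exists (iota (T f)); first exact: adjoint_energy_on.
  move=> [h e] /= /adjoint_energyP he.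
  by rewrite innerC [RHS]innerC he.
by move=> [h _ [<- <-]].
Qed.

Lemma krein_neumann_ge0 h : 0 <= inner (A h) h.
Proof.
rewrite krein_neumann_sym; have [e he [e' he' ->]] := krein_neumann_factor h h.
by rewrite (adjoint_energy_inj he' he) inner_normE exprn_ge0.
Qed.

(** Serves twice: [M = sqrt 2 * |h|] yields [A <= 2], and [M = <B h, h>^(1/2)] yields minimality
    against a positive extension [B]. *)
Lemma krein_neumann_le h (M : R) : 0 <= M ->
  (forall f, D f -> rnorm (inner (T f) h) <= M * form_norm energy f) ->
  inner (A h) h <= of_real (M ^+ 2).
Proof.
move=> M0 hM; rewrite krein_neumann_sym.
have [e he [e' he' ->]] := krein_neumann_factor h h.
rewrite (adjoint_energy_inj he' he) inner_rnorm.
rewrite ler_of_real ler_sqr ?nnegrE ?rnorm_ge0//.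
exact: (adjoint_energy_rnorm_le he).
Qed.

End EnergyCompletion.

(** * Construction of a completion of [ran T] inside [H] *)

Section EnergySpace.
Context {R : realType} {k : scalar_kind} {H : hilbertType R k}.
Variables (D : set H) (T : H -> H) (c : R).
Local Notation K := (scalars R k).
Local Notation conj := (scalar_conj R k).
Local Notation re := (@scalar_re R k).
Local Notation energy := (fun f g => inner (T f) g).
Local Notation q := (form_norm energy).
Hypotheses (T_lin : linear_on D T) (T_pos : pos_form D energy).
Hypotheses (c0 : 0 <= c) (T_bounded : forall f, D f -> rnorm (T f) <= c * q f).
Local Notation subD := (pf_subspace T_pos).
Implicit Types (e : R) (f g h x y : H) (u v : nat -> H) (a : K).

(* [T g] is [e]-close to [x] both in [H] and in the energy norm, the latter being
   expressed by duality against [D]. *)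
Definition energy_close e g x := [/\ D g, rnorm (x - T g) <= e &
  forall f, D f -> rnorm (inner (x - T g) f) <= e * q f].

Definition energy_repr u x := (forall n, D (u n)) /\
  forall e, 0 < e -> exists N, forall n, (N <= n)%N -> energy_close e (u n) x.

(* The range of the injective operator [J_T^**], i.e. the completion of [ran T]
   realised inside [H]. *)
Definition energy_space : set H :=
  [set x | forall e, 0 < e -> exists g, energy_close e g x].

Lemma energy_close_lin a e d g h x y : energy_close e g x ->
  energy_close d h y ->
  energy_close (rnorm a * e + d) (a *: g + h) (a *: x + y).
Proof.
move=> [Dg xg xgf] [Dh yh yhf].
have Dag := subspaceZ subD a Dg.
have E : a *: x + y - T (a *: g + h) = a *: (x - T g) + (y - T h).
  by rewrite T_lin// opprD addrACA scalerBr.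
split; first exact: (subspaceD subD).
  rewrite E; apply: le_trans (rnormD _ _) _; rewrite rnormZ lerD//.
  by rewrite ler_wpM2l ?rnorm_ge0.
move=> f Df; rewrite E innerDl innerZl mulrDl.
apply: le_trans (rnormD _ _) _; rewrite rnormM -mulrA lerD ?yhf//.
by rewrite ler_wpM2l ?rnorm_ge0 ?xgf.
Qed.

Lemma energy_close_le e d g x : e <= d ->
  energy_close e g x -> energy_close d g x.
Proof.
move=> ed [Dg xg xgf]; split=> // [|f Df]; first exact: le_trans ed.
by rewrite (le_trans (xgf _ Df))// ler_wpM2r// form_norm_ge0.
Qed.

Lemma energy_close_self g : D g -> energy_close 0 g (T g).
Proof.
move=> Dg; split; rewrite ?subrr ?rnorm0// => f Df.
by rewrite (pf0l inner_pos)// rnorm0 mul0r.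
Qed.

(** Testing both duality clauses at [f = g - h] gives [q f ^ 2 = Re <(x - T h) - (x - T g), f> <= (e
    + d) * q f]. So approximants of one vector are automatically close in energy. *)
Lemma energy_close_dist e d g h x : energy_close e g x -> energy_close d h x ->
  q (g - h) <= e + d.
Proof.
move=> [Dg xg xgf] [Dh xh xhf]; have Dgh := subspaceB subD Dg Dh.
have := form_norm_ge0 (b := energy) (g - h).
rewrite le_eqVlt => /orP[/eqP <-|gh0].
  by rewrite addr_ge0// (le_trans (rnorm_ge0 _) xg, le_trans (rnorm_ge0 _) xh).
rewrite -(ler_pM2r gh0) -expr2 (sqr_form_norm T_pos)//.
have -> : T (g - h) = (x - T h) - (x - T g).
  by rewrite (linear_onB subD T_lin)// opprB [RHS]addrC subrKA.
rewrite innerBl; apply: le_trans (scalar_re_rnorm _) _.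
apply: le_trans (rnormD _ _) _; rewrite rnormN mulrDl addrC.
by rewrite lerD ?xgf ?xhf.
Qed.

Lemma energy_space_repr x : energy_space x -> exists u, energy_repr u x.
Proof.
move=> Ex; have [|u uP] := choice (fun n => Ex (n.+1%:R^-1) _).
  by move=> n; rewrite invr_gt0.
exists u; split=> [n|e e0]; first by have [] := uP n.
have [N Ne] := archi_inv e0; exists N => n Nn.
exact: energy_close_le (Ne _ Nn) (uP n).
Qed.

Lemma energy_repr_space u x : energy_repr u x -> energy_space x.
Proof. by move=> [_ ux] e /ux[N uN]; exists (u N); exact: uN. Qed.

Lemma energy_repr_lin a u v x y : energy_repr u x -> energy_repr v y ->
  energy_repr (fun n => a *: u n + v n) (a *: x + y).
Proof.
move=> [Du ux] [Dv vy]; split=> [n|e e0].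
  by apply: (subspaceD subD) => //; exact: (subspaceZ subD).
have a1 : 0 < rnorm a + 1 by rewrite ltr_wpDl ?rnorm_ge0.
have [N uN] := ux _ (divr_gt0 e0 a1); have [M vM] := vy _ (divr_gt0 e0 a1).
exists (maxn N M) => n; rewrite geq_max => /andP[/uN un /vM vn].
have := energy_close_lin a un vn; apply: energy_close_le.
by rewrite -[X in _ + X]mul1r -mulrDl mulrC divfK// gt_eqF.
Qed.

Lemma energy_repr_self g : D g -> energy_repr (fun=> g) (T g).
Proof.
move=> Dg; split=> // e e0; exists 0%N => n _.
exact: energy_close_le (ltW e0) (energy_close_self Dg).
Qed.

Lemma energy_repr_bounded u x : energy_repr u x ->
  exists2 M, 0 <= M & exists N, forall n, (N <= n)%N -> q (u n) <= M.
Proof.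
move=> [Du /(_ 1 ltr01)[N uN]]; exists (2 + q (u N)).
  by rewrite addr_ge0// form_norm_ge0.
exists N => n Nn; have := energy_close_dist (uN n Nn) (uN N (leqnn _)).
have := form_norm_le_add T_pos (Du n) (Du N); lra.
Qed.

(** With [u' = u] and [v' = v] this is the Cauchy property of the energies; in general it also gives
    independence of the representing sequences. *)
Lemma energy_repr_cauchy u u' v v' x y : energy_repr u x -> energy_repr u' x ->
  energy_repr v y -> energy_repr v' y ->
  forall e, 0 < e -> exists N, forall m n, (N <= m)%N -> (N <= n)%N ->
  rnorm (energy (u m) (v m) - energy (u' n) (v' n)) <= e.
Proof.
move=> ux ux' vy vy' e e0.
have [A A0 [N1 vA]] := energy_repr_bounded vy.
have [B B0 [N2 uB]] := energy_repr_bounded ux'.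
(* The two Cauchy-Schwarz terms are at most [2 * d * A] and [B * (2 * d)]; the [1] keeps the
   denominator of [d] positive. *)
have AB0 : 0 < 2 * (A + B + 1) by lra.
have d0 := divr_gt0 e0 AB0; set d := e / _ in d0.
have eE : e = d * (2 * (A + B + 1)) by rewrite divfK// gt_eqF.
move: ux ux' vy vy' => [Du ux] [Du' ux'] [Dv vy] [Dv' vy'].
have [N3 uN] := ux _ d0; have [N4 uN'] := ux' _ d0.
have [N5 vN] := vy _ d0; have [N6 vN'] := vy' _ d0.
exists (maxn (maxn N1 N2) (maxn (maxn N3 N4) (maxn N5 N6))) => m n.
rewrite !geq_max => /andP[/andP[/vA qv _] /andP[/andP[um _] /andP[vm _]]].
move=> /andP[/andP[_ /uB qu] /andP[/andP[_ un] /andP[_ vn]]].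
have uu := energy_close_dist (uN _ um) (uN' _ un).
have vv := energy_close_dist (vN _ vm) (vN' _ vn).
have Duu := subspaceB subD (Du m) (Du' n).
have Dvv := subspaceB subD (Dv m) (Dv' n).
rewrite (_ : _ - _ =
    energy (u m - u' n) (v m) + energy (u' n) (v m - v' n)); last first.
  by rewrite (pfBl T_pos)// (pfBr T_pos)// addrA subrK.
apply: le_trans (rnormD _ _) _.
have := form_CauchySchwarz T_pos Duu (Dv m).
have := form_CauchySchwarz T_pos (Du' n) Dvv.
have := ler_pM (form_norm_ge0 _) (form_norm_ge0 _) uu qv.
have := ler_pM (form_norm_ge0 _) (form_norm_ge0 _) qu vv.
rewrite eE; lra.
Qed.

(** Quantifying over all representing sequences builds independence into the definition. Outside
    [energy_space] the condition is vacuous and the value arbitrary. *)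
Definition energy_form x y : K := xget 0 [set z | forall u v,
  energy_repr u x -> energy_repr v y ->
  (fun n => energy (u n) (v n)) @ \oo --> (z : K)].

Lemma energy_form_cvg u v x y : energy_repr u x -> energy_repr v y ->
  (fun n => energy (u n) (v n)) @ \oo --> energy_form x y.
Proof.
move=> ux vy; rewrite /energy_form; set P := [set z | _].
suff [z Pz] : exists z, P z by exact: (xgetPex 0 (ex_intro _ z Pz)).
have [//| |z _ uvz] := @scalars_seq_complete R k (fun n => energy (u n) (v n)).
  exact: (energy_repr_cauchy ux ux vy vy).
exists z => u' v' ux' vy'; apply/cvg_rnormP => e e0.
have e20 : 0 < e / 2 by rewrite divr_gt0.
have [N uvN] := energy_repr_cauchy ux' ux vy' vy e20.
have [M uvM] := uvz _ e20; exists (maxn N M) => n.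
rewrite geq_max => /andP[Nn Mn].
apply: le_trans (rnorm_triangle (energy (u n) (v n)) _ _) _.
by rewrite [e]splitr lerD ?uvN ?uvM.
Qed.

Lemma energy_formE u v x y (z : K) : energy_repr u x -> energy_repr v y ->
  (fun n => energy (u n) (v n)) @ \oo --> z -> energy_form x y = z.
Proof.
by move=> ux vy; apply: cvg_unique => //; exact: energy_form_cvg.
Qed.

Lemma energy_form_ran g h : D g -> D h -> energy_form (T g) (T h) = energy g h.
Proof.
move=> Dg Dh.
apply: energy_formE (energy_repr_self Dg) (energy_repr_self Dh) _.
exact: cvg_cst.
Qed.

Lemma energy_space_sub : linear_subspace energy_space.
Proof.
have D0 := subspace0 subD; split.
  rewrite -(linear_on0 subD T_lin).
  exact: energy_repr_space (energy_repr_self D0).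
move=> a x y /energy_space_repr[u ux] /energy_space_repr[v vy].
exact: energy_repr_space (energy_repr_lin a ux vy).
Qed.

Lemma energy_space_ran g : D g -> energy_space (T g).
Proof. by move=> /energy_repr_self/energy_repr_space. Qed.

Lemma energy_form_pos : pos_form energy_space energy_form.
Proof.
split=> [|a x y z|x y|x]; first exact: energy_space_sub.
- move=> /energy_space_repr[u ux] /energy_space_repr[v vy].
  move=> /energy_space_repr[w wz].
  apply: (energy_formE (energy_repr_lin a ux vy) wz).
  rewrite (_ : (fun _ => _) = (fun n => a *: (energy (u n) (w n) : K^o)
      + energy (v n) (w n))).
    apply: cvgD; last exact: (energy_form_cvg vy wz).
    by apply: cvgZr; exact: (energy_form_cvg ux wz).
  apply/funext => n; rewrite (pf_linear T_pos)//;
    by case: ux vy wz => [Du _] [Dv _] [Dw _].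
- move=> /energy_space_repr[u ux] /energy_space_repr[v vy].
  apply: (energy_formE vy ux); apply/cvg_rnormP => e e0.
  have /cvg_rnormP/(_ e e0)[N uvN] := energy_form_cvg ux vy.
  case: ux vy => [Du _] [Dv _].
  exists N => n /uvN; rewrite -rnorm_conj rmorphB /=.
  by rewrite -(pf_herm T_pos).
- move=> /energy_space_repr[u ux].
  have ul := energy_form_cvg ux ux.
  (* [0 <= z] in [K] includes that [z] is real, so the limit is shown real before the sign of its
     real part is examined. *)
  have zr : conj (energy_form x x) = energy_form x x.
    apply/esym/(energy_formE ux ux)/cvg_rnormP => e e0.
    have /cvg_rnormP/(_ e e0)[N uvN] := ul.
    exists N => n /uvN; rewrite -rnorm_conj rmorphB /=.
    by case: ux => [Du _]; rewrite -(pf_herm T_pos).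
  rewrite -(scalar_conj_fixed zr) -of_real0 ler_of_real.
  apply: (@le_of_small _ 1) => // e e0 _; rewrite mul1r.
  have /cvg_rnormP/(_ e e0)[N /(_ N (leqnn _)) uN] := ul.
  have := le_trans (scalar_re_rnorm _) uN; rewrite scalar_reB.
  have := scalar_re_ge0 (pf_ge0 T_pos (ux.1 N)); lra.
Qed.

Local Notation qE := (form_norm energy_form).

Lemma energy_norm_ran g : D g -> qE (T g) = q g.
Proof. by move=> Dg; rewrite /form_norm energy_form_ran. Qed.

(** Identifies the ad hoc closeness with the norm of the completion: if [u] represents [x], then
    [u n - g] represents [x - T g], and [energy_close_dist] bounds its energy. *)
Lemma energy_close_norm e g x : energy_close e g x -> energy_space x ->
  qE (x - T g) <= e.
Proof.
move=> xg Ex; have [Dg xg1 _] := xg.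
have e0 : 0 <= e := le_trans (rnorm_ge0 _) xg1.
have Exg := subspaceB energy_space_sub Ex (energy_space_ran Dg).
have [u ux] := energy_space_repr Ex.
have ug : energy_repr (fun n => u n - g) (x - T g).
  have := energy_repr_lin (-1) (energy_repr_self Dg) ux.
  rewrite !scaleN1r addrC; congr energy_repr.
  by apply/funext => n; rewrite addrC.
have ul := energy_form_cvg ug ug.
rewrite -ler_sqr ?nnegrE ?form_norm_ge0// (sqr_form_norm energy_form_pos)//.
apply: (@le_of_small _ (2 * e + 2)) => [|d d0 d1]; first by lra.
have /cvg_rnormP/(_ d d0)[N uN] := ul.
have [Du /(_ d d0)[M uM]] := ux.
have {}uN := uN _ (leq_maxl N M); have {}uM := uM _ (leq_maxr N M).
set n := maxn N M in uN uM.
have qu := energy_close_dist uM xg.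
rewrite rnormB in uN; have := le_trans (scalar_re_rnorm _) uN.
rewrite scalar_reB -(sqr_form_norm T_pos); last exact: (ug.1 n).
have := form_norm_ge0 (b := energy) (u n - g).
move=> q0; have := ler_pM q0 q0 qu qu; rewrite -!expr2.
have := ler_wpM2l (ltW d0) d1; lra.
Qed.

Lemma energy_space_rnorm x : energy_space x -> rnorm x <= c * qE x.
Proof.
move=> Ex; apply: (@le_of_small _ (1 + c)) => [|e e0 _].
  by rewrite addr_ge0.
have [g xg] := Ex _ e0; have [Dg xg1 _] := xg.
have := energy_close_norm xg Ex.
have := form_norm_le_add energy_form_pos (energy_space_ran Dg) Ex.
rewrite (form_normB energy_form_pos (energy_space_ran Dg) Ex).
rewrite energy_norm_ran// => h1 h2.
have /(ler_wpM2l c0) : q g <= e + qE x by lra.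
have := T_bounded Dg; have := rnormD (x - T g) (T g); rewrite subrK; lra.
Qed.

(** In the completion [inner x f] is the energy product of [x] and [T f], so this is Cauchy-Schwarz
    there, obtained by approximating [x]. *)
Lemma energy_space_inner x f : energy_space x -> D f ->
  rnorm (inner x f) <= qE x * q f.
Proof.
move=> Ex Df; apply: (@le_of_small _ (2 * q f)) => [|e e0 _].
  by rewrite mulr_ge0// form_norm_ge0.
have [g xg] := Ex _ e0; have [Dg _ xgf] := xg.
have := energy_close_norm xg Ex.
have := form_norm_le_add energy_form_pos (energy_space_ran Dg) Ex.
rewrite (form_normB energy_form_pos (energy_space_ran Dg) Ex).
rewrite energy_norm_ran// => h1 h2.
have /(ler_wpM2r (form_norm_ge0 (b := energy) f)) : q g <= e + qE x by lra.
have := form_CauchySchwarz T_pos Dg Df.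
have := xgf _ Df; have := rnormD (inner (x - T g) f) (inner (T g) f).
rewrite -innerDl subrK; lra.
Qed.

Lemma energy_form_definite x : energy_space x -> energy_form x x = 0 -> x = 0.
Proof.
move=> Ex x0; apply/rnorm0_eq0/eqP; rewrite eq_le rnorm_ge0 andbT.
have := energy_space_rnorm Ex.
by rewrite /form_norm x0 scalar_re0 sqrtr0 mulr0.
Qed.

(** An energy-Cauchy sequence is Cauchy in [H], which supplies a candidate [x]; an approximant [T g]
    of a late [u n] is then shown close to [x] by passing through [u m] and letting [m] grow. *)
Lemma energy_space_complete : seq_complete energy_space qE.
Proof.
move=> u Eu uc; have subE := energy_space_sub.
have [//| |x _ ux] := @normed_seq_complete _ _ H u.
  move=> e e0; have c1 : 0 < c + 1 by rewrite ltr_wpDl.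
  have [N uN] := uc _ (divr_gt0 e0 c1); exists N => m n Nm Nn.
  apply: le_trans (energy_space_rnorm (subspaceB subE (Eu m) (Eu n))) _.
  apply: le_trans (ler_wpM2l c0 (uN m n Nm Nn)) _.
  by rewrite mulrCA ger_pMr// ler_pdivrMr// mul1r lerDl.
have close e : 0 < e -> exists N, forall n, (N <= n)%N ->
    exists2 g, D g & energy_close e g x /\ qE (T g - u n) <= e.
  (* Three bounds must fit under [e]: [(c + 1) * d] in norm, [2 * d] against [D], and [d] in energy;
     [c + 3] dominates all the factors. *)
  move=> e0; have c3 : 0 < c + 3 by rewrite ltr_wpDl.
  have d0 := divr_gt0 e0 c3; set d := e / _ in d0.
  have eE : e = d * (c + 3) by rewrite divfK// gt_eqF.
  have [N uN] := uc _ d0; exists N => n Nn.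
  have [g ug] := Eu n _ d0; have [Dg ug1 ugf] := ug.
  have Eg := energy_space_ran Dg.
  have nug := energy_close_norm ug (Eu n).
  exists g => //; split; last first.
    rewrite (form_normB energy_form_pos)//; apply: le_trans nug _.
    by rewrite eE ler_peMr ?(ltW d0)// -[leLHS]add0r lerD// ler1n.
  have limit f : D f -> rnorm (inner (x - T g) f) <= 2 * d * q f.
    move=> Df; apply: (@le_of_small _ (rnorm f)) => [|eta eta0 _].
      exact: rnorm_ge0.
    have [M uM] := ux _ eta0; have {}uM := uM _ (leq_maxr N M).
    have {}uN := uN _ _ (leq_maxl N M) Nn; set m := maxn N M in uM uN.
    have := energy_space_inner (subspaceB subE (Eu m) (Eu n)) Df.
    have := ler_wpM2r (form_norm_ge0 (b := energy) f) uN.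
    have := inner_CauchySchwarz (x - u m) f; rewrite rnormB in uM.
    have := ler_wpM2r (rnorm_ge0 f) uM.
    have := ugf _ Df.
    have := rnormD (inner (x - u m) f)
      (inner (u m - u n) f + inner (u n - T g) f).
    have := rnormD (inner (u m - u n) f) (inner (u n - T g) f).
    rewrite -!innerDl !subrKA; lra.
  split=> // [|f Df]; last first.
    apply: le_trans (limit f Df) _; rewrite ler_wpM2r ?form_norm_ge0// eE.
    by rewrite mulrC ler_wpM2l ?(ltW d0)// -[leLHS]add0r lerD// ler_nat.
  apply: (@le_of_small _ 1) => // eta eta0 _; rewrite mul1r.
  have [M uM] := ux _ eta0; have {}uM := uM _ (leq_maxr N M).
  have {}uN := uN _ _ (leq_maxl N M) Nn; set m := maxn N M in uM uN.
  have := energy_space_rnorm (subspaceB subE (Eu m) (Eu n)).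
  have := ler_wpM2l c0 uN; rewrite rnormB in uM.
  have := rnorm_triangle (u m) x (T g).
  have := rnorm_triangle (u n) (u m) (T g).
  rewrite eE; lra.
have Ex : energy_space x.
  move=> e /close[N /(_ N (leqnn _))[g _ [xg _]]]; by exists g.
exists x => // e e0; have e20 : 0 < e / 2 by rewrite divr_gt0.
have [N cN] := close _ e20; exists N => n /cN[g Dg [xg gn]].
have Eg := energy_space_ran Dg.
have := energy_close_norm xg Ex; rewrite (form_normB energy_form_pos)// => gx.
rewrite (form_normB energy_form_pos)// in gn.
have := form_norm_triangle energy_form_pos (Eu n) Eg Ex; lra.
Qed.

Definition energy_hspace : hspace H :=
  HSpace energy_form_pos energy_form_definite energy_space_complete.

Lemma energy_completion_ex :
  exists (E : hilbertType R k) (iota : H -> E), energy_completion D T iota.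
Proof.
(* [iota] is the identity on the energy space; the default [0] is taken only outside it, hence never
   on [ran T]. *)
pose s := energy_hspace; pose iota (x : H) : hs_type s := insubd 0 x.
have iotaK x : energy_space x -> val (iota x) = x.
  by move=> Ex; rewrite insubdK//; exact/hs_predP.
exists (hs_type s), iota; split.
- move=> a _ _ [f Df <-] [g Dg <-]; apply: val_inj.
  rewrite linearP /= !iotaK//; try exact: energy_space_ran.
  by rewrite -T_lin//; apply: energy_space_ran; case: subD => _; exact.
- move=> f h Df Dh; rewrite -energy_form_ran//.
  by rewrite inner_hs !iotaK//; exact: energy_space_ran.
- apply/denseP_rnorm => x e e0; have Ex : energy_space (val x) := hs_valP x.
  have [g xg] := Ex _ e0; have [Dg _ _] := xg.
  exists (iota (T g)); first by exists (T g) => //; exists g.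
  rewrite rnorm_hsB iotaK; first exact: energy_close_norm.
  exact: energy_space_ran.
Qed.

End EnergySpace.

(** * Operator norm, self-adjointness and contractions *)

Section OperatorNorm.
Context {R : realType} {k : scalar_kind} {H : hilbertType R k}.
Local Notation K := (scalars R k).
Local Notation re := (@scalar_re R k).
Implicit Types (D : set H) (S A B : H -> H).

Lemma opnorm_le1P D S : linear_subspace D -> linear_on D S ->
  (opnorm D S <= 1)%E <-> forall f, D f -> rnorm (S f) <= rnorm f.
Proof.
move=> subD S_lin; split=> [S1 f Df|S1].
  have [f0|f0] := eqVneq (rnorm f) 0.
    by rewrite f0 (rnorm0_eq0 f0) (linear_on0 subD S_lin) rnorm0.
  have {}f0 : 0 < rnorm f by rewrite lt_neqAle eq_sym f0 rnorm_ge0.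
  pose r : K := of_real (rnorm f)^-1.
  have rE : rnorm r = (rnorm f)^-1 by rewrite rnorm_real// invr_ge0 rnorm_ge0.
  have Drf := subspaceZ subD r Df.
  have : ((rnorm (S (r *: f)))%:E <= opnorm D S)%E.
    apply: ereal_sup_ubound; exists (r *: f) => //; split=> //.
    by rewrite -of_rnorm rnormZ rE mulVf ?gt_eqF// of_real1.
  move=> /le_trans/(_ S1); rewrite lee_fin (linear_onZ subD S_lin)// rnormZ rE.
  by rewrite ler_pdivrMl// mulr1.
apply: ge_ereal_sup => _ [f [Df f1] <-]; rewrite lee_fin.
apply: le_trans (S1 f Df) _.
by rewrite -(@ler_of_real _ k) of_rnorm of_real1.
Qed.

Lemma opnorm_extends D S A : extends D S A -> (opnorm D S <= opnorm setT A)%E.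
Proof.
move=> SA; apply: le_ereal_sup => _ [f [Df f1] <-].
by exists f => //; rewrite SA.
Qed.

(** Moving [A] to the other factor leaves an expression linear in the first one. The function
    returned by [get] obtains its linearity in this way. *)
Lemma symmetric_linear A : (forall x y, inner (A x) y = inner x (A y)) ->
  linear A.
Proof.
move=> A_sym a x y; apply: innerI => z.
by rewrite A_sym !innerDl !innerZl -!A_sym.
Qed.

Lemma self_adjointP A :
  self_adjoint A <-> forall x y, inner (A x) y = inner x (A y).
Proof.
split=> [sA x y|A_sym].
  have : adjoint (graph setT A) (y, A y) by rewrite sA; exists y.
  by move=> /(_ (x, A x)); apply; exists x.
apply/seteqP; split=> [[y z] yz|_ [y _ <-] _ [x _ <-]]; last exact: A_sym.
exists y => //; congr pair; apply: innerI => x.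
have /= := yz (x, A x) (ex_intro2 _ _ x I erefl).
by rewrite A_sym innerC [inner x z]innerC => /(can_inj scalar_conjK).
Qed.

Lemma symmetric_pos_form A : (forall x y, inner (A x) y = inner x (A y)) ->
  (forall x, 0 <= inner (A x) x) -> pos_form setT (fun x y => inner (A x) y).
Proof.
move=> A_sym A0; split=> // [a x y z _ _ _|x y _ _].
- by rewrite symmetric_linear// innerDl innerZl.
- by rewrite A_sym innerC.
Qed.

Lemma pos_form_ker A x : pos_form setT (fun x y => inner (A x) y) ->
  inner (A x) x = 0 -> A x = 0.
Proof.
move=> A_pos Ax0; apply/rnorm0_eq0/eqP; rewrite -sqrf_eq0 -re_inner.
rewrite (rnorm0_eq0 (_ : rnorm (inner (A x) (A x)) = 0)) ?scalar_re0//.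
apply/eqP; rewrite eq_le rnorm_ge0 andbT.
(* Pairing [x] with [A x] in the form of [A] gives [|A x|^2] on the left and a vanishing factor on
   the right. *)
apply: le_trans (form_CauchySchwarz A_pos (x := x) (y := A x) I I) _.
by rewrite {1}/form_norm Ax0 scalar_re0 sqrtr0 mul0r.
Qed.

(* For [0 <= A <= 2] Cauchy-Schwarz gives [|A x|^2 <= 2 <A x, x>], and
   [|A x - x|^2 = |A x|^2 - 2 <A x, x> + |x|^2]. *)
Lemma symmetric_contraction A : (forall x y, inner (A x) y = inner x (A y)) ->
  op_le (\- id) A -> op_le A id -> forall x, rnorm (A x) <= rnorm x.
Proof.
move=> A_sym A_ge A_le x; pose B y := A y + y.
have B_pos : pos_form setT (fun x y => inner (B x) y).
  apply: symmetric_pos_form => [y z|y].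
    by rewrite /B innerDl innerDr A_sym.
  by rewrite /B innerDl -lerBlDr sub0r -(pfNl inner_pos)//; exact: A_ge.
have B_le y : re (inner (B y) y) <= 2 * rnorm y ^+ 2.
  have := A_le y; rewrite -subr_ge0 => /scalar_re_ge0.
  by rewrite scalar_reB /B innerDl scalar_reD re_inner; lra.
have : rnorm (B x) ^+ 2 <= 2 * re (inner (B x) x).
  have [->|Bx0] := eqVneq (rnorm (B x)) 0.
    by rewrite expr0n mulr_ge0// scalar_re_ge0// (pf_ge0 B_pos).
  have {}Bx0 : 0 < rnorm (B x) ^+ 2.
    by rewrite exprn_gt0// lt_neqAle eq_sym Bx0 rnorm_ge0.
  rewrite -(ler_pM2l Bx0) -{2}re_inner.
  (* This reads [|B x|^4 <= <B x, x> <B (B x), B x>], and the last factor is at most [2 * |B x|^2],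
     which is then cancelled. *)
  have := form_CauchySchwarz B_pos (x := x) (y := B x) I I.
  move=> /(le_trans (scalar_re_rnorm _)); rewrite re_inner => CS.
  have CS2 := ler_pM (ltW Bx0) (ltW Bx0) CS CS; move: CS2.
  rewrite [form_norm _ x * _ * _]mulrACA -[form_norm _ x * _]expr2.
  rewrite -[form_norm _ (B x) * _]expr2 !(sqr_form_norm B_pos)//.
  have := B_le (B x); rewrite -re_inner.
  have := scalar_re_ge0 (pf_ge0 B_pos (I : setT x)).
  by move=> /ler_wpM2l h /h; lra.
move=> Bx2; have -> : A x = B x - x by rewrite /B addrK.
rewrite -ler_sqr ?nnegrE ?rnorm_ge0// sqr_rnormB; lra.
Qed.

Lemma contraction_op_ge A : (forall x y, inner (A x) y = inner x (A y)) ->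
  (forall x, rnorm (A x) <= rnorm x) -> op_le (\- id) A /\ op_le A id.
Proof.
move=> A_sym A1; have A_re x : of_real (re (inner (A x) x)) = inner (A x) x.
  by apply: scalar_conj_fixed; rewrite -innerC A_sym.
have A_bound x : rnorm (inner (A x) x) <= rnorm x ^+ 2.
  apply: le_trans (inner_CauchySchwarz _ _) _.
  by rewrite expr2 ler_wpM2r ?rnorm_ge0.
split=> x /=; rewrite ?(pfNl inner_pos)// -A_re inner_rnorm.
  rewrite -of_realN ler_of_real lerNl -scalar_reN.
  by apply: le_trans (scalar_re_rnorm _) _; rewrite rnormN.
rewrite ler_of_real; exact: le_trans (scalar_re_rnorm _) _.
Qed.

End OperatorNorm.

(** * The extension of [I + S] and its shift by [I] *)

Section KreinNeumann.
Context {R : realType} {k : scalar_kind} {H : hilbertType R k}.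
Local Notation K := (scalars R k).
Local Notation re := (@scalar_re R k).
Variables (D : set H) (S : H -> H).
Hypotheses (D_subspace : linear_subspace D) (S_linear : linear_on D S).
Hypotheses (S_symmetric : symmetric_on D S).
Hypothesis S_contraction : forall f, D f -> rnorm (S f) <= rnorm f.
Local Notation T := (id \+ S).
Local Notation A := (krein_neumann D T).

Let T_lin : linear_on D T.
Proof.
by move=> a x y Dx Dy /=; rewrite S_linear// scalerDr addrACA.
Qed.

Let T_pos : pos_form D (fun f g => inner (T f) g).
Proof.
split=> // [a x y z Dx Dy Dz|x y Dx Dy|x Dx].
- by rewrite T_lin// innerDl innerZl.
- by rewrite -innerC /= innerDl innerDr S_symmetric.
- have Sx : of_real (re (inner (S x) x)) = inner (S x) x.
    by apply: scalar_conj_fixed; rewrite -innerC S_symmetric.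
  rewrite /= innerDl -Sx inner_rnorm -of_realD -of_real0 ler_of_real.
  rewrite addrC -lerBlDr sub0r lerNl -scalar_reN.
  apply: le_trans (scalar_re_rnorm _) _; rewrite rnormN.
  apply: le_trans (inner_CauchySchwarz _ _) _.
  by rewrite expr2 ler_wpM2r ?rnorm_ge0 ?S_contraction.
Qed.

(** Since [|S f| <= |f|], [|f + S f|^2 = |f|^2 + |S f|^2 + 2 Re <S f, f> <= 2 (|f|^2 + Re <S f,
    f>)]; hence the constant [sqrt 2]. *)
Let T_bounded f : D f ->
  rnorm (T f) <= Num.sqrt 2 * form_norm (fun f g => inner (T f) g) f.
Proof.
move=> Df; rewrite -ler_sqr ?nnegrE ?mulr_ge0 ?form_norm_ge0 ?rnorm_ge0//.
rewrite exprMn sqr_sqrtr// (sqr_form_norm T_pos)//= sqr_rnormD innerDl.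
rewrite scalar_reD re_inner [inner f _]innerC scalar_re_conj.
have Sf := S_contraction Df.
by have := ler_pM (rnorm_ge0 _) (rnorm_ge0 _) Sf Sf; rewrite -!expr2; lra.
Qed.

(** The explicit completion only proves existence; afterwards [A] is known through some unspecified
    completion. *)
Let A_is_kn : is_krein_neumann D T A.
Proof.
have [E [iota compl]] :=
  energy_completion_ex T_lin T_pos (sqrtr_ge0 2) T_bounded.
have [B BP] := krein_neumann_ex T_lin T_pos compl (sqrtr_ge0 2) T_bounded.
by apply: (@getPex _ (is_krein_neumann D T)); exists B, E, iota.
Qed.

Lemma kn_sym x y : inner (A x) y = inner x (A y).
Proof.
have [E [iota [compl AE]]] := A_is_kn.
exact: (krein_neumann_sym T_lin T_pos compl T_bounded AE).
Qed.

Lemma kn_extends f : D f -> A f = f + S f.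
Proof.
have [E [iota [compl AE]]] := A_is_kn.
exact: (krein_neumann_extends compl AE).
Qed.

Lemma kn_ge0 x : 0 <= inner (A x) x.
Proof.
have [E [iota [compl AE]]] := A_is_kn.
exact: (krein_neumann_ge0 T_lin T_pos compl T_bounded AE).
Qed.

Lemma kn_le2 x : inner (A x) x <= inner x x + inner x x.
Proof.
have [E [iota [compl AE]]] := A_is_kn.
have := krein_neumann_le T_lin T_pos compl T_bounded AE
  (h := x) (M := Num.sqrt 2 * rnorm x).
rewrite exprMn sqr_sqrtr// mulrDl mul1r of_realD.
rewrite inner_rnorm; apply.
  by rewrite mulr_ge0 ?rnorm_ge0.
move=> f Df; apply: le_trans (inner_CauchySchwarz _ _) _.
by rewrite mulrAC ler_wpM2r ?rnorm_ge0 ?T_bounded.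
Qed.

(** Cauchy-Schwarz for [B] gives [|<T f, x>| = |<B f, x>| <= <B x, x>^(1/2) <T f, f>^(1/2)] on
    [D]. *)
Lemma kn_min B : pos_form setT (fun x y => inner (B x) y) ->
  extends D T B -> op_le A B.
Proof.
move=> B_pos TB x; have [E [iota [compl AE]]] := A_is_kn.
rewrite -(of_sqr_form_norm B_pos (I : setT x)).
apply: (krein_neumann_le T_lin T_pos compl T_bounded AE).
  exact: form_norm_ge0.
move=> f Df; rewrite -TB// mulrC.
rewrite (_ : form_norm _ f = form_norm (fun x y => inner (B x) y) f).
  exact: (form_CauchySchwarz B_pos).
by rewrite /form_norm TB.
Qed.

Lemma kn_shift :
  let C := A \- id in
  [/\ forall x y, inner (C x) y = inner x (C y), extends D S C &
      forall x, rnorm (C x) <= rnorm x].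
Proof.
have C_sym x y : inner ((A \- id) x) y = inner x ((A \- id) y).
  by rewrite /= innerBl innerBr kn_sym.
split=> // [f Df|]; first by rewrite /= kn_extends// addrC addKr.
apply: symmetric_contraction => // x /=.
  by rewrite (pfNl inner_pos)// innerBl -lerBlDr opprK addrC subrr kn_ge0.
by rewrite innerBl lerBlDr kn_le2.
Qed.

Lemma kn_shift_min B : (forall x y, inner (B x) y = inner x (B y)) ->
  (forall x, rnorm (B x) <= rnorm x) -> extends D S B -> op_le (A \- id) B.
Proof.
move=> B_sym B1 SB x; rewrite /= innerBl lerBlDr addrC -innerDl.
apply: (@kn_min (id \+ B)) => [|f Df]; last by rewrite /= SB.
have [B_ge _] := contraction_op_ge B_sym B1.
apply: symmetric_pos_form => [y z|y] /=.
  by rewrite innerDl innerDr B_sym.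
rewrite innerDl addrC -lerBlDr sub0r -(pfNl inner_pos)//.
exact: B_ge.
Qed.

End KreinNeumann.

(** * Norm one versus contractivity for extensions of [S] *)

Section SelfAdjointContractions.
Context {R : realType} {k : scalar_kind} {H : hilbertType R k}.
Variables (D : set H) (S A : H -> H).
Hypothesis S_norm1 : opnorm D S = 1%E.
Hypotheses (A_sym : forall x y, inner (A x) y = inner x (A y)).
Hypotheses (SA : extends D S A).

(** The norm of an extension is at least that of [S], which is [1]; only the upper bound carries
    information. *)
Lemma opnorm_eq1P : opnorm setT A = 1%E <-> forall x, rnorm (A x) <= rnorm x.
Proof.
have A_lin : linear_on setT A by move=> a x y _ _; exact: symmetric_linear.
have := opnorm_le1P linear_subspaceT A_lin.
move=> [le1 ge1]; split=> [A1 x|A1]; first by apply: le1; rewrite // A1.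
apply/eqP; rewrite eq_le -{2}S_norm1 (opnorm_extends SA) andbT.
by apply: ge1 => x _; exact: A1.
Qed.

Lemma self_adjoint_contraction : (forall x, rnorm (A x) <= rnorm x) ->
  [/\ bounded_operator A, self_adjoint A, extends D S A & opnorm setT A = 1%E].
Proof.
move=> /opnorm_eq1P A1; split=> //; last exact/self_adjointP.
by split; [exact: symmetric_linear|rewrite A1 ltry].
Qed.

End SelfAdjointContractions.

Theorem theorem7p6 (R : realType) (k : scalar_kind) (H : hilbertType R k)
    (D : set H) (S : H -> H)
    (D_subspace : linear_subspace D) (S_linear : linear_on D S)
    (S_symmetric : symmetric_on D S) (S_norm1 : opnorm D S = 1%E) :
  let S_m := krein_neumann D (id \+ S) \- id in
  let S_M := id \- krein_neumann D (id \- S) in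
  [/\ [/\ bounded_operator S_m, self_adjoint S_m, extends D S S_m
        & opnorm setT S_m = 1%E],
      [/\ bounded_operator S_M, self_adjoint S_M, extends D S S_M
        & opnorm setT S_M = 1%E]
    & op_interval S_m S_M =
      [set S' | [/\ bounded_operator S', self_adjoint S', opnorm setT S' = 1%E
                  & extends D S S']]].
Proof.
move=> S_m S_M.
have S1 : forall f, D f -> rnorm (S f) <= rnorm f.
  by apply/(opnorm_le1P D_subspace S_linear); rewrite S_norm1.
pose N := \- S.
have N_lin : linear_on D N.
  by move=> a x y Dx Dy; rewrite /N /= S_linear// opprD scalerN.
have N_sym : symmetric_on D N.
  by move=> f g Df Dg; rewrite /N /= (pfNl inner_pos)// (pfNr inner_pos)//
    S_symmetric.
have N1 f : D f -> rnorm (N f) <= rnorm f by move=> Df; rewrite rnormN S1.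
have [m_sym m_ext m1] := kn_shift D_subspace S_linear S_symmetric S1.
have [M_sym M_ext M1] := kn_shift D_subspace N_lin N_sym N1.
(* [id \- S] and [id \+ N] are convertible, so everything proved for the lower extension applies to
   [N = - S]. *)
have SME x : S_M x = - (krein_neumann D (id \+ N) \- id) x.
  by rewrite /S_M /= opprB.
have SM_sym x y : inner (S_M x) y = inner x (S_M y).
  by rewrite !SME (pfNl inner_pos)// (pfNr inner_pos)// M_sym.
have SM_ext : extends D S S_M.
  by move=> f Df; rewrite SME M_ext// opprK.
have SM1 x : rnorm (S_M x) <= rnorm x by rewrite SME rnormN M1.
split; [exact: self_adjoint_contraction|exact: self_adjoint_contraction|].
apply/seteqP; split=> A [A_bnd A_sa].
  have /self_adjointP A_sym := A_sa => A_ge A_le.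
  (* From [- I <= S_m <= A <= S_M <= I]. *)
  have A1 : forall x, rnorm (A x) <= rnorm x.
    apply: symmetric_contraction => // x.
      by apply: le_trans (A_ge x); case: (contraction_op_ge m_sym m1).
    by apply: le_trans (A_le x) _; case: (contraction_op_ge SM_sym SM1).
  have A_ext : extends D S A.
    move=> f Df; apply/eqP; rewrite -subr_eq0 -(m_ext f Df); apply/eqP.
    apply: (@pos_form_ker _ _ _ (fun x => A x - S_m x)).
      apply: symmetric_pos_form => [x y|x].
        by rewrite innerBl innerBr A_sym m_sym.
      by rewrite innerBl subr_ge0 A_ge.
    (* On [D] both bounds agree with [S], so [<(A - S_m) f, f>] is squeezed to [0]. *)
    apply/eqP; rewrite eq_le innerBl subr_ge0 A_ge andbT subr_le0.
    by apply: le_trans (A_le f) _; rewrite SM_ext// [S_m f]m_ext.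
  by split=> //; apply/(opnorm_eq1P S_norm1 A_sym A_ext).
move=> A_norm A_ext; have /self_adjointP A_sym := A_sa.
have /(opnorm_eq1P S_norm1 A_sym A_ext) A1 := A_norm.
split=> //; first exact: kn_shift_min.
move=> x; rewrite SME (pfNl inner_pos)// lerNr.
rewrite -(pfNl inner_pos)//.
(* [- A] is a symmetric contraction extending [- S]; minimality of [- S_M] among these is the upper
   bound for [A]. *)
apply: (@kn_shift_min _ _ _ D N _ _ _ _ (\- A)) => //.
- by move=> y z /=; rewrite (pfNl inner_pos)// (pfNr inner_pos)// A_sym.
- by move=> y; rewrite /= rnormN A1.
- by move=> f Df; rewrite /= A_ext.
Qed.
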